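(* Let $m,n,l,\nu,\sigma,r\in\mathbb{T}$ with $|\operatorname{Im}_j(m)|<\operatorname{Re}(m)$, $|\operatorname{Im}_j(n)|<\operatorname{Re}(n)$, $|\operatorname{Im}_j(\nu)|<\operatorname{Re}(\nu)$. Then for every real $x>0$, $$\int_0^x(x-t)^{n-1}\,\mathbb{E}_{m,n}^{l}\big(r(x-t)^m\big)\,t^{\nu-1}\,\mathbb{E}_{m,\nu}^{\sigma}\big(rt^m\big)\,dt=x^{n+\nu-1}\,\mathbb{E}_{m,n+\nu}^{l+\sigma}\big(rx^m\big).$$
   Context: Bicomplex numbers: $\mathbb{T}=\{x_0+i_1x_1+i_2x_2+jx_3: x_0,\dots,x_3\in\mathbb{R}\}$ is the commutative ring with $i_1^2=i_2^2=-1$, $i_1i_2=i_2i_1=j$, $j^2=1$. For $\xi=x_0+i_1x_1+i_2x_2+jx_3$ put $\operatorname{Re}(\xi)=x_0$, $\operatorname{Im}_j(\xi)=x_3$. Let $e_1=(1+j)/2$, $e_2=(1-j)/2$. Writing $\xi=z_1+i_2z_2$ with $z_1,z_2\in\mathbb{C}=\mathbb{R}(i_1)$, one has uniquely $\xi=\xi_1e_1+\xi_2e_2$ with $\xi_1=z_1-i_1z_2$, $\xi_2=z_1+i_1z_2\in\mathbb{C}$; ring operations are componentwise in this idempotent representation. Integrals of bicomplex-valued functions $f=f_1e_1+f_2e_2$ are taken componentwise. For $t>0$, $t^{\xi}=t^{\xi_1}e_1+t^{\xi_2}e_2$. The bicomplex Gamma function is $\Gamma_2(\xi)=\Gamma(\xi_1)e_1+\Gamma(\xi_2)e_2$.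 The Pochhammer symbol is $(l)_0=1$, $(l)_u=l(l+1)\cdots(l+u-1)$. The bicomplex Prabhakar function is $\mathbb{E}_{m,n}^l(\zeta)=\sum_{u=0}^\infty\frac{(l)_u}{u!\,\Gamma_2(mu+n)}\zeta^u$ for $\zeta,m,n,l\in\mathbb{T}$ with $|\operatorname{Im}_j(m)|<\operatorname{Re}(m)$, $|\operatorname{Im}_j(n)|<\operatorname{Re}(n)$. *)

(* Defs.v *)
From HB Require Import structures.
From mathcomp Require Import all_boot all_order all_algebra.
From mathcomp Require Import all_classical all_reals all_analysis.
From mathcomp Require Export complex.
From mathcomp Require Import ring.

Set Implicit Arguments.
Unset Strict Implicit.
Unset Printing Implicit Defensive.

Import Order.TTheory GRing.Theory Num.Theory.
Import numFieldNormedType.Exports.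

Local Open Scope classical_set_scope.
Local Open Scope ring_scope.
Local Open Scope complex_scope.

(** [Bicomplex x0 x1 x2 x3] is x0 + i1 x1 + i2 x2 + j x3; the field i1 -> R[i]
    identifies the subring R(i1) with the library's complex numbers [R[i]]. *)
Record bicomplex (R : Type) : Type :=
  Bicomplex { bc0 : R; bc1 : R; bc2 : R; bc3 : R }.

Definition bc_tuple (R : Type) (x : bicomplex R) : R * R * R * R :=
  (bc0 x, bc1 x, bc2 x, bc3 x).
Definition tuple_bc (R : Type) (p : R * R * R * R) : bicomplex R :=
  Bicomplex p.1.1.1 p.1.1.2 p.1.2 p.2.
Lemma bc_tupleK (R : Type) : cancel (@bc_tuple R) (@tuple_bc R).
Proof. by case. Qed.

HB.instance Definition _ (R : realType) :=
  Choice.copy (bicomplex R) (can_type (@bc_tupleK R)).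

Section BicomplexRing.
Variable R : realType.
Implicit Types x y z : bicomplex R.

Definition bc_zero : bicomplex R := Bicomplex 0 0 0 0.
Definition bc_one : bicomplex R := Bicomplex 1 0 0 0.
Definition bc_opp x := Bicomplex (- bc0 x) (- bc1 x) (- bc2 x) (- bc3 x).
Definition bc_add x y :=
  Bicomplex (bc0 x + bc0 y) (bc1 x + bc1 y) (bc2 x + bc2 y) (bc3 x + bc3 y).

(** Bilinear extension of i1^2 = i2^2 = -1, i1 i2 = i2 i1 = j, j^2 = 1,
    whence i1 j = - i2 and i2 j = - i1. *)
Definition bc_mul x y :=
  Bicomplex
    (bc0 x * bc0 y - bc1 x * bc1 y - bc2 x * bc2 y + bc3 x * bc3 y)
    (bc0 x * bc1 y + bc1 x * bc0 y - bc2 x * bc3 y - bc3 x * bc2 y)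
    (bc0 x * bc2 y + bc2 x * bc0 y - bc1 x * bc3 y - bc3 x * bc1 y)
    (bc0 x * bc3 y + bc3 x * bc0 y + bc1 x * bc2 y + bc2 x * bc1 y).

Lemma bc_addA : associative bc_add.
Proof. by move=> x y z; congr Bicomplex; apply: addrA. Qed.
Lemma bc_addC : commutative bc_add.
Proof. by move=> x y; congr Bicomplex; apply: addrC. Qed.
Lemma bc_add0 : left_id bc_zero bc_add.
Proof. by case=> *; congr Bicomplex; apply: add0r. Qed.
Lemma bc_addN : left_inverse bc_zero bc_opp bc_add.
Proof. by case=> *; congr Bicomplex; apply: addNr. Qed.

HB.instance Definition _ := GRing.isZmodule.Build (bicomplex R)
  bc_addA bc_addC bc_add0 bc_addN.

Lemma bc_mulA : associative bc_mul.
Proof. by move=> x y z; congr Bicomplex => /=; ring. Qed.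
Lemma bc_mulC : commutative bc_mul.
Proof. by move=> x y; congr Bicomplex => /=; ring. Qed.
Lemma bc_mul1 : left_id bc_one bc_mul.
Proof. by case=> *; congr Bicomplex => /=; ring. Qed.
Lemma bc_mulD : left_distributive bc_mul bc_add.
Proof. by move=> x y z; congr Bicomplex => /=; ring. Qed.
Lemma bc_one_neq0 : bc_one != 0.
Proof. by apply/eqP => -[] /eqP; rewrite oner_eq0. Qed.

HB.instance Definition _ := GRing.Zmodule_isComNzRing.Build (bicomplex R)
  bc_mulA bc_mulC bc_mul1 bc_mulD bc_one_neq0.

End BicomplexRing.

Section Idempotents.
Variable R : realType.
Implicit Types (xi x y : bicomplex R) (a b : R[i]).

Definition bc_i1 : bicomplex R := Bicomplex 0 1 0 0.
Definition bc_i2 : bicomplex R := Bicomplex 0 0 1 0.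
Definition bc_j : bicomplex R := Bicomplex 0 0 0 1.
Definition bc_e1 : bicomplex R := Bicomplex 2^-1 0 0 2^-1.
Definition bc_e2 : bicomplex R := Bicomplex 2^-1 0 0 (- 2^-1).

Definition bc_Re xi : R := bc0 xi.
Definition bc_Imj xi : R := bc3 xi.

Definition bc_of_complex a : bicomplex R := Bicomplex (complex.Re a) (complex.Im a) 0 0.

(** xi = z1 + i2 z2 with z1, z2 in R(i1); recall i2 i1 = j. *)
Definition bc_z1 xi : R[i] := bc0 xi +i* bc1 xi.
Definition bc_z2 xi : R[i] := bc2 xi +i* bc3 xi.

Definition bc_idem1 xi : R[i] := bc_z1 xi - 'i * bc_z2 xi.
Definition bc_idem2 xi : R[i] := bc_z1 xi + 'i * bc_z2 xi.
Definition bc_of_idem a b : bicomplex R :=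
  bc_of_complex a * bc_e1 + bc_of_complex b * bc_e2.

Lemma bc_e1E : bc_e1 + bc_e1 = 1 + bc_j.
Proof. by congr Bicomplex => /=; field. Qed.

Lemma bc_e2E : bc_e2 + bc_e2 = 1 - bc_j.
Proof. by congr Bicomplex => /=; field. Qed.

Lemma bc_i1i1 : bc_i1 * bc_i1 = -1.
Proof. by congr Bicomplex => /=; ring. Qed.

Lemma bc_i2i2 : bc_i2 * bc_i2 = -1.
Proof. by congr Bicomplex => /=; ring. Qed.

Lemma bc_i1i2 : bc_i1 * bc_i2 = bc_j.
Proof. by congr Bicomplex => /=; ring. Qed.

Lemma bc_jj : bc_j * bc_j = 1.
Proof. by congr Bicomplex => /=; ring. Qed.

Lemma bc_z12E xi : xi = bc_of_complex (bc_z1 xi) + bc_i2 * bc_of_complex (bc_z2 xi).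
Proof. by case: xi => *; congr Bicomplex => /=; ring. Qed.

Lemma bc_idem1E xi : bc_idem1 xi = (bc0 xi + bc3 xi) +i* (bc1 xi - bc2 xi).
Proof. by congr Complex => /=; ring. Qed.

Lemma bc_idem2E xi : bc_idem2 xi = (bc0 xi - bc3 xi) +i* (bc1 xi + bc2 xi).
Proof. by congr Complex => /=; ring. Qed.

Lemma bc_of_idemE a b : bc_of_idem a b =
  Bicomplex ((complex.Re a + complex.Re b) / 2) ((complex.Im a + complex.Im b) / 2)
            ((complex.Im b - complex.Im a) / 2) ((complex.Re a - complex.Re b) / 2).
Proof. by congr Bicomplex => /=; ring. Qed.

Lemma bc_of_idemK1 a b : bc_idem1 (bc_of_idem a b) = a.
Proof. by rewrite bc_idem1E bc_of_idemE; case: a => ? ?; congr Complex => /=; field. Qed.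

Lemma bc_of_idemK2 a b : bc_idem2 (bc_of_idem a b) = b.
Proof. by rewrite bc_idem2E bc_of_idemE; case: b => ? ?; congr Complex => /=; field. Qed.

Lemma bc_idemK xi : bc_of_idem (bc_idem1 xi) (bc_idem2 xi) = xi.
Proof.
by rewrite bc_idem1E bc_idem2E bc_of_idemE; case: xi => *; congr Bicomplex => /=; field.
Qed.

Lemma bc_idem_inj x y :
  bc_idem1 x = bc_idem1 y -> bc_idem2 x = bc_idem2 y -> x = y.
Proof. by move=> e1 e2; rewrite -(bc_idemK x) e1 e2 bc_idemK. Qed.

Lemma bc_idem1_is_zmod_morphism : zmod_morphism bc_idem1.
Proof. by move=> x y; rewrite !bc_idem1E; congr Complex => /=; ring. Qed.
Lemma bc_idem2_is_zmod_morphism : zmod_morphism bc_idem2.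
Proof. by move=> x y; rewrite !bc_idem2E; congr Complex => /=; ring. Qed.
Lemma bc_idem1_is_monoid_morphism : monoid_morphism bc_idem1.
Proof.
by split=> [|x y]; rewrite !bc_idem1E; congr Complex => /=; ring.
Qed.
Lemma bc_idem2_is_monoid_morphism : monoid_morphism bc_idem2.
Proof.
by split=> [|x y]; rewrite !bc_idem2E; congr Complex => /=; ring.
Qed.

HB.instance Definition _ := GRing.isZmodMorphism.Build (bicomplex R) R[i]
  bc_idem1 bc_idem1_is_zmod_morphism.
HB.instance Definition _ := GRing.isZmodMorphism.Build (bicomplex R) R[i]
  bc_idem2 bc_idem2_is_zmod_morphism.
HB.instance Definition _ := GRing.isMonoidMorphism.Build (bicomplex R) R[i]
  bc_idem1 bc_idem1_is_monoid_morphism.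
HB.instance Definition _ := GRing.isMonoidMorphism.Build (bicomplex R) R[i]
  bc_idem2 bc_idem2_is_monoid_morphism.

Definition bc_unit : {pred bicomplex R} :=
  fun xi => (bc_idem1 xi != 0) && (bc_idem2 xi != 0).
Definition bc_inv xi : bicomplex R :=
  if bc_unit xi then bc_of_idem (bc_idem1 xi)^-1 (bc_idem2 xi)^-1 else xi.

Lemma bc_mulVx : {in bc_unit, left_inverse 1 bc_inv *%R}.
Proof.
move=> x xU; rewrite /bc_inv ifT //; case/andP: xU => x1 x2.
apply: bc_idem_inj; rewrite rmorphM rmorph1 /=.
  by rewrite bc_of_idemK1 mulVf.
by rewrite bc_of_idemK2 mulVf.
Qed.

Lemma bc_unitP x y : y * x = 1 -> bc_unit x.
Proof.
move=> yx1; apply/andP; split; apply/negP => /eqP x0.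
- have := congr1 bc_idem1 yx1.
  by rewrite rmorphM rmorph1 /= x0 mulr0 => /esym/eqP; rewrite oner_eq0.
- have := congr1 bc_idem2 yx1.
  by rewrite rmorphM rmorph1 /= x0 mulr0 => /esym/eqP; rewrite oner_eq0.
Qed.

Lemma bc_inv_out : {in [predC bc_unit], bc_inv =1 id}.
Proof. by move=> x /negbTE xU; rewrite /bc_inv -[bc_unit x]/(x \in bc_unit) xU. Qed.

HB.instance Definition _ := GRing.ComNzRing_hasMulInverse.Build (bicomplex R)
  bc_mulVx bc_unitP bc_inv_out.

End Idempotents.

Section Analysis.
Variable R : realType.
Local Notation mu := (@lebesgue_measure R).

Definition cexp (z : R[i]) : R[i] :=
  (expR (complex.Re z) * cos (complex.Im z)) +i*
  (expR (complex.Re z) * sin (complex.Im z)).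

(** t^z = exp (z ln t), meant for real t > 0. *)
Definition crpow (t : R) (z : R[i]) : R[i] := cexp (z * (ln t)%:C).

Definition c_integrable (D : set R) (f : R -> R[i]) : Prop :=
  mu.-integrable D (EFin \o (fun t => complex.Re (f t))) /\
  mu.-integrable D (EFin \o (fun t => complex.Im (f t))).
Definition c_integral (D : set R) (f : R -> R[i]) : R[i] :=
  (\int[mu]_(t in D) complex.Re (f t))%R +i* (\int[mu]_(t in D) complex.Im (f t))%R.

Definition pochhammer (A : pzRingType) (l : A) (u : nat) : A :=
  \prod_(k < u) (l + k%:R).

Definition euler_integral (z : R[i]) : R[i] :=
  c_integral `]0, +oo[ (fun t => crpow t (z - 1) * (expR (- t))%:C).

(** The complex Gamma function: Euler's integral when Re z > 0 (there the
    number of shifts [Num.truncn (1 - Re z)] is 0), continued elsewhere by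
    Gamma z = Gamma (z + k) / (z)_k, with k the least natural number making
    Re (z + k) > 0.  At the poles (z)_k = 0 and the value is 0, so that the
    inverse is 0 as well, as usual for the reciprocal Gamma function. *)
Definition cGamma (z : R[i]) : R[i] :=
  let k := Num.truncn (1 - complex.Re z) in
  euler_integral (z + k%:R) / pochhammer z k.

Lemma cGammaE (z : R[i]) : 0 < complex.Re z -> cGamma z = euler_integral z.
Proof.
move=> z_gt0; rewrite /cGamma (_ : Num.truncn _ = 0)%N.
  by rewrite addr0 /pochhammer big_ord0 divr1.
by apply/truncn0Pn; rewrite -ltNge ltrBlDr ltrDl.
Qed.

Definition bc_integrable (D : set R) (f : R -> bicomplex R) : Prop :=
  c_integrable D (fun t => bc_idem1 (f t)) /\
  c_integrable D (fun t => bc_idem2 (f t)).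
Definition bc_integral (D : set R) (f : R -> bicomplex R) : bicomplex R :=
  bc_of_idem (c_integral D (fun t => bc_idem1 (f t)))
             (c_integral D (fun t => bc_idem2 (f t))).

Definition bc_rpow (t : R) (xi : bicomplex R) : bicomplex R :=
  bc_of_idem (crpow t (bc_idem1 xi)) (crpow t (bc_idem2 xi)).

Definition bc_Gamma (xi : bicomplex R) : bicomplex R :=
  bc_of_idem (cGamma (bc_idem1 xi)) (cGamma (bc_idem2 xi)).

(** Limits in the Euclidean topology of the four real coordinates. *)
Definition bc_lim (s : nat -> bicomplex R) : bicomplex R :=
  Bicomplex (limn (fun N => bc0 (s N))) (limn (fun N => bc1 (s N)))
            (limn (fun N => bc2 (s N))) (limn (fun N => bc3 (s N))).

Definition prabhakar (m n l zeta : bicomplex R) : bicomplex R :=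
  bc_lim (fun N => \sum_(0 <= u < N)
    pochhammer l u / (u`!%:R * bc_Gamma (m * u%:R + n)) * zeta ^+ u).

End Analysis.

(* Main.v *)
Require Import Defs.
From mathcomp Require Import all_boot all_order all_algebra.
From mathcomp Require Import all_classical all_reals all_analysis.
From mathcomp Require Import measurable_realfun ring lra.
Set Implicit Arguments.
Unset Strict Implicit.
Unset Printing Implicit Defensive.
Import Order.TTheory GRing.Theory Num.Theory.
Import numFieldNormedType.Exports.
Import Normc.
Local Open Scope classical_set_scope.
Local Open Scope ring_scope.
Local Open Scope complex_scope.

(** Ring operations, powers, Gamma, limits and integrals are all computed
    componentwise in the idempotent representation, and the hypotheses
    |Im_j xi| < Re xi say exactly that both idempotent components of xi have
    positive real part.  So the theorem is two instances of the same identity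
    over the complex numbers ([cprabhakar_convolution]).

    Over the complex numbers, expand both Prabhakar functions.  The term of
    index (p, q) of the product is, up to a constant, the convolution kernel
    (x-t)^(mp+n-1) t^(mq+nu-1), whose integral is x^(m(p+q)+n+nu-1) times the
    Beta integral B(mp+n, mq+nu) = Gamma(mp+n) Gamma(mq+nu) / Gamma(m(p+q)+n+nu).
    The two Gamma factors cancel those of the coefficients, what remains depends
    on p and q only through p+q apart from the binomial coefficients, and the
    Chu-Vandermonde identity ([binom_coef_Vandermonde]) sums the diagonals to the
    series of the right-hand side.

    Three analytic facts justify this.

    - The Beta-Gamma relation for complex arguments ([euler_integralM]): the
      product of two Euler integrals is an iterated integral, which Fubini's
      theorem and the homogeneity of the convolution of two power kernels
      ([ckernel_conv]) turn into Gamma(a+b) B(a,b).  Its version for real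
      arguments in the extended reals ([rgammaM]) comes first, by Tonelli's
      theorem; it also yields the finiteness of the real Gamma and Beta
      integrals that Fubini's theorem needs.

    - Gamma has no zero in the right half-plane ([euler_integral_neq0]).  If
      Gamma(z) = 0, the Beta-Gamma relation gives Gamma(z/k) = 0 and then
      Gamma(1+z/k) = 0 for all k >= 1; but Gamma(1+z/k) tends to Gamma(1) = 1.

    - The reciprocals 1/Gamma(mk+n) decay faster than any geometric sequence
      ([geometric_inv_euler_integral_le]), although m is complex.  Since
      |B(a,b)| <= 2 B(Re a, Re b), the ratio rho(z) = |Gamma(z)| / Gamma(Re z)
      satisfies rho(a) rho(b) <= 2 rho(a+b).  Iterating, rho(mk+n) decreases at
      most geometrically, whereas Gamma(k Re m + Re n) exceeds every geometric
      sequence.  The same bound gives the convergence of the series, the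
      majorant that lets the limit pass under the integral, and the
      comparison of square and triangular partial sums of the double series. *)

(** * Complex numbers, exponential and powers of a positive real *)

Section ComplexNumbers.
Variable R : realType.
Implicit Types (z w : R[i]) (t s : R).

Lemma cReD z w : complex.Re (z + w) = complex.Re z + complex.Re w.
Proof. by case: z; case: w. Qed.

Lemma cImD z w : complex.Im (z + w) = complex.Im z + complex.Im w.
Proof. by case: z; case: w. Qed.

Lemma cReB z w : complex.Re (z - w) = complex.Re z - complex.Re w.
Proof. by case: z; case: w. Qed.

Lemma cImB z w : complex.Im (z - w) = complex.Im z - complex.Im w.
Proof. by case: z; case: w. Qed.

Lemma cReM z w : complex.Re (z * w) =
  complex.Re z * complex.Re w - complex.Im z * complex.Im w.
Proof. by case: z; case: w. Qed.

Lemma cImM z w : complex.Im (z * w) =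
  complex.Re z * complex.Im w + complex.Im z * complex.Re w.
Proof. by case: z => a b; case: w => c d /=; rewrite addrC; congr (_ + _); rewrite mulrC. Qed.

Lemma Re_natr (k : nat) : complex.Re (k%:R : R[i]) = k%:R.
Proof. by rewrite -(rmorph_nat (real_complex R)). Qed.

Lemma Im_natr (k : nat) : complex.Im (k%:R : R[i]) = 0.
Proof. by rewrite -(rmorph_nat (real_complex R)). Qed.

Lemma ReMnatr z (k : nat) : complex.Re (z * k%:R) = complex.Re z * k%:R.
Proof. by rewrite cReM Re_natr Im_natr mulr0 subr0. Qed.

Lemma Re1 : complex.Re (1 : R[i]) = 1. Proof. by []. Qed.

Lemma complex_eq z w : complex.Re z = complex.Re w ->
  complex.Im z = complex.Im w -> z = w.
Proof. by case: z; case: w => ? ? ? ? /= -> ->. Qed.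

Lemma normc_ge0 z : 0 <= normc z.
Proof. by case: z => a b; exact: sqrtr_ge0. Qed.

Lemma abs_Re_le z : `|complex.Re z| <= normc z.
Proof.
by case: z => a b /=; rewrite -sqrtr_sqr ler_sqrt ?addr_ge0 ?sqr_ge0// lerDl sqr_ge0.
Qed.

Lemma abs_Im_le z : `|complex.Im z| <= normc z.
Proof.
by case: z => a b /=; rewrite -sqrtr_sqr ler_sqrt ?addr_ge0 ?sqr_ge0// lerDr sqr_ge0.
Qed.

Lemma normc_real (x : R) : normc x%:C = `|x|.
Proof. by rewrite /normc /= expr0n /= addr0 sqrtr_sqr. Qed.

Lemma normc_le_ReIm z : normc z <= `|complex.Re z| + `|complex.Im z|.
Proof.
case: z => a b /=.
rewrite -[leRHS]ger0_norm ?addr_ge0// -sqrtr_sqr ler_sqrt ?sqr_ge0//.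
rewrite sqrrD !real_normK ?num_real// -addrA lerD2l lerDr.
by rewrite mulrn_wge0// mulr_ge0.
Qed.

Lemma normcX z (k : nat) : normc (z ^+ k) = normc z ^+ k.
Proof.
elim: k => [|k IH]; first by rewrite !expr0 normc1.
by rewrite !exprS normcM IH.
Qed.

Lemma normcD z w : normc (z + w) <= normc z + normc w.
Proof. by have := le_normcD z w. Qed.

Lemma normc_sum (I : Type) (s : seq I) (P : pred I) (F : I -> R[i]) :
  normc (\sum_(i <- s | P i) F i) <= \sum_(i <- s | P i) normc (F i).
Proof.
elim/big_rec2 : _ => [|i y1 y2 Pi IH]; first by rewrite normc0.
by rewrite (le_trans (normcD _ _))// lerD2l.
Qed.

Lemma normc_neq0 z : (normc z != 0) = (z != 0).
Proof.
congr negb; apply/eqP/eqP => [/eq0_normc//|->]; exact: normc0.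
Qed.

Lemma normc_gt0 z : (0 < normc z) = (z != 0).
Proof. by rewrite lt_def normc_ge0 andbT normc_neq0. Qed.

Lemma normc_natr (k : nat) : normc (k%:R : R[i]) = k%:R.
Proof. by rewrite -(rmorph_nat (real_complex R)) normc_real ger0_norm. Qed.

Lemma cexpD z w : cexp (z + w) = cexp z * cexp w.
Proof.
apply: complex_eq; rewrite ?cReM ?cImM /cexp/= cReD cImD expRD ?cosD ?sinD; ring.
Qed.

Lemma cexp0 : cexp (0 : R[i]) = 1.
Proof. by apply: complex_eq; rewrite /cexp /= expR0 ?cos0 ?sin0 mul1r. Qed.

Lemma normc_cexp z : normc (cexp z) = expR (complex.Re z).
Proof.
rewrite /cexp /= !exprMn -mulrDr cos2Dsin2 mulr1 sqrtr_sqr ger0_norm//.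
Qed.

Lemma crpowD t z w : crpow t (z + w) = crpow t z * crpow t w.
Proof. by rewrite /crpow mulrDl cexpD. Qed.

Lemma crpow0 t : crpow t (0 : R[i]) = 1.
Proof. by rewrite /crpow mul0r cexp0. Qed.

Lemma crpowMn t z (k : nat) : crpow t (z * k%:R) = crpow t z ^+ k.
Proof.
elim: k => [|k IH]; first by rewrite mulr0 crpow0 expr0.
by rewrite -addn1 natrD mulrDr mulr1 crpowD IH addn1 exprSr.
Qed.

Lemma crpowM s t z : 0 < s -> 0 < t -> crpow (s * t) z = crpow s z * crpow t z.
Proof.
by move=> s0 t0; rewrite /crpow lnM ?posrE// rmorphD mulrDr cexpD.
Qed.

Lemma Re_crpow t z :
  complex.Re (crpow t z) = expR (complex.Re z * ln t) * cos (complex.Im z * ln t).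
Proof. by rewrite /crpow /cexp /= ?cReM ?cImM /= !mulr0 subr0 add0r. Qed.

Lemma Im_crpow t z :
  complex.Im (crpow t z) = expR (complex.Re z * ln t) * sin (complex.Im z * ln t).
Proof. by rewrite /crpow /cexp /= ?cReM ?cImM /= !mulr0 subr0 add0r. Qed.

Lemma normc_crpow t z : 0 < t -> normc (crpow t z) = t `^ complex.Re z.
Proof.
move=> t0; rewrite normc_cexp cReM /= mulr0 subr0.
by rewrite /powR gt_eqF.
Qed.

End ComplexNumbers.

(** * Measurability and integration of complex-valued functions *)

Definition c_measurable {d} {T : measurableType d} {R : realType} (D : set T)
    (f : T -> R[i]) : Prop :=
  measurable_fun D (fun t => complex.Re (f t)) /\
  measurable_fun D (fun t => complex.Im (f t)).

Section ComplexMeasurable.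
Context {d} {T : measurableType d} {R : realType}.
Implicit Types (D : set T) (f g : T -> R[i]).

Lemma c_measurableM D f g :
  c_measurable D f -> c_measurable D g -> c_measurable D (fun t => f t * g t).
Proof.
move=> [rf jf] [rg jg]; split.
  under eq_fun do rewrite cReM.
  by apply: measurable_funD; [|apply: measurable_funN]; apply: measurable_funM.
under eq_fun do rewrite cImM.
by apply: measurable_funD; apply: measurable_funM.
Qed.

Lemma c_measurable_real D (f : T -> R) :
  measurable_fun D f -> c_measurable D (fun t => (f t)%:C).
Proof. by move=> mf; split => //=; exact: measurable_cst. Qed.

Lemma measurable_normc D f :
  c_measurable D f -> measurable_fun D (fun t => normc (f t)).
Proof.
move=> [rf jf].
have -> : (fun t => normc (f t)) =
  (fun t => Num.sqrt (complex.Re (f t) ^+ 2 + complex.Im (f t) ^+ 2)).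
  by apply/funext => t; case: (f t).
apply: measurableT_comp; first exact: continuous_measurable_fun (@sqrt_continuous R).
by apply: measurable_funD; exact: measurable_funX.
Qed.

Lemma c_measurable_comp d' (T' : measurableType d') f (h : T' -> T) :
  c_measurable setT f -> measurable_fun setT h ->
  c_measurable setT (fun t => f (h t)).
Proof.
move=> [rf jf] mh; split.
  exact: (measurableT_comp rf mh).
exact: (measurableT_comp jf mh).
Qed.

End ComplexMeasurable.

Section ComplexIntegral.
Context {R : realType}.
Local Notation mu := (@lebesgue_measure R).
Local Notation TR := (measurableTypeR R).
Implicit Types (D : set TR) (f g : R -> R[i]).

Lemma c_integrable_le D f (g : R -> R) : measurable D -> c_measurable D f ->
  (forall t, D t -> normc (f t) <= g t) ->
  mu.-integrable D (EFin \o g) -> c_integrable D f.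
Proof.
move=> mD [rf jf] fg ig; split; apply: le_integrable ig => //;
  try exact/measurable_EFinP.
- move=> t Dt /=; rewrite lee_fin (le_trans (abs_Re_le (f t)))// (le_trans (fg _ Dt))//.
  exact: ler_norm.
- move=> t Dt /=; rewrite lee_fin (le_trans (abs_Im_le (f t)))// (le_trans (fg _ Dt))//.
  exact: ler_norm.
Qed.

Lemma c_integrable_measurable D f : c_integrable D f -> c_measurable D f.
Proof.
by move=> [/measurable_int/measurable_EFinP rf /measurable_int/measurable_EFinP jf].
Qed.

Lemma eq_c_integral D f g : (forall t, D t -> f t = g t) ->
  c_integral D f = c_integral D g.
Proof.
by move=> fg; congr Complex; apply: eq_Rintegral => t; rewrite inE => /fg ->.
Qed.

Lemma c_integrableD D f g : measurable D -> c_integrable D f -> c_integrable D g ->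
  c_integrable D (fun t => f t + g t).
Proof.
move=> mD [rf jf] [rg jg]; split.
  rewrite (_ : _ \o _ = (EFin \o (fun t => complex.Re (f t))) \+
    (EFin \o (fun t => complex.Re (g t))))%E; first exact: integrableD.
  by apply/funext => t /=; rewrite cReD.
rewrite (_ : _ \o _ = (EFin \o (fun t => complex.Im (f t))) \+
    (EFin \o (fun t => complex.Im (g t))))%E; first exact: integrableD.
by apply/funext => t /=; rewrite cImD.
Qed.

Lemma c_integralD D f g : measurable D -> c_integrable D f -> c_integrable D g ->
  c_integral D (fun t => f t + g t) = c_integral D f + c_integral D g.
Proof.
move=> mD [rf jf] [rg jg]; congr Complex => /=.
  by rewrite -RintegralD//; apply: eq_Rintegral => t _; rewrite cReD.
by rewrite -RintegralD//; apply: eq_Rintegral => t _; rewrite cImD.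
Qed.

Let integrableZ D (k : R) (f : R -> R) : measurable D ->
  mu.-integrable D (EFin \o f) -> mu.-integrable D (EFin \o (fun t => k * f t)).
Proof.
move=> mD intf; have := integrableZl mD k intf; apply: eq_integrable => // t _.
Qed.

Lemma c_integrableZ D (z : R[i]) f : measurable D -> c_integrable D f ->
  c_integrable D (fun t => z * f t).
Proof.
move=> mD [rf jf]; split.
  rewrite (_ : _ \o _ = (EFin \o (fun t => complex.Re z * complex.Re (f t))%R) \-
    (EFin \o (fun t => complex.Im z * complex.Im (f t))%R))%E.
    by apply: integrableB => //; exact: integrableZ.
  by apply/funext => t /=; rewrite cReM.
rewrite (_ : _ \o _ = (EFin \o (fun t => complex.Re z * complex.Im (f t))%R) \+
    (EFin \o (fun t => complex.Im z * complex.Re (f t))%R))%E.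
  by apply: integrableD => //; exact: integrableZ.
by apply/funext => t /=; rewrite cImM.
Qed.

Lemma c_integralZ D (z : R[i]) f : measurable D -> c_integrable D f ->
  c_integral D (fun t => z * f t) = z * c_integral D f.
Proof.
move=> mD [rf jf]; apply: complex_eq; rewrite ?cReM ?cImM /=.
  rewrite -!RintegralZl// -RintegralB//; [|exact: integrableZ..].
  by apply: eq_Rintegral => t _; rewrite cReM.
rewrite -!RintegralZl// -RintegralD//; [|exact: integrableZ..].
by apply: eq_Rintegral => t _; rewrite cImM.
Qed.

Lemma c_integrable0 D : c_integrable D (fun=> 0).
Proof. by split; exact: integrable0. Qed.

Lemma c_integral0 D : c_integral D (fun=> 0) = 0.
Proof.
apply: complex_eq => /=;
by rewrite /Rintegral (eq_integral (cst 0%E))// integral0.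
Qed.

Lemma c_integrable_sum D (I : Type) (s : seq I) (c : I -> R[i]) (f : I -> R -> R[i]) :
  measurable D -> (forall i, c_integrable D (f i)) ->
  c_integrable D (fun t => \sum_(i <- s) c i * f i t).
Proof.
move=> mD intf; elim: s => [|i s IH].
  by under eq_fun do rewrite big_nil; exact: c_integrable0.
under eq_fun do rewrite big_cons.
by apply: c_integrableD => //; exact: c_integrableZ.
Qed.

Lemma c_integral_sum D (I : Type) (s : seq I) (c : I -> R[i]) (f : I -> R -> R[i]) :
  measurable D -> (forall i, c_integrable D (f i)) ->
  c_integral D (fun t => \sum_(i <- s) c i * f i t) =
  \sum_(i <- s) c i * c_integral D (f i).
Proof.
move=> mD intf; elim: s => [|i s IH].
  by under eq_fun do rewrite big_nil; rewrite big_nil c_integral0.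
under eq_fun do rewrite big_cons.
rewrite big_cons c_integralD ?c_integralZ ?IH//; first exact: c_integrableZ.
exact: c_integrable_sum.
Qed.

(** The constant 2 comes from bounding the real and the imaginary part
    separately.  It is not sharp, but a constant factor is harmless here: it
    only changes the ratio of a geometric sequence. *)
Lemma normc_c_integral_le D f (g : R -> R) : measurable D ->
  c_integrable D f -> mu.-integrable D (EFin \o g) ->
  (forall t, D t -> normc (f t) <= g t) ->
  normc (c_integral D f) <= 2 * \int[mu]_(t in D) g t.
Proof.
move=> mD [rf jf] ig fg; rewrite (le_trans (normc_le_ReIm (c_integral D f)))//= mulr2n mulrDl mul1r.
have H (h : R -> R) : mu.-integrable D (EFin \o h) ->
    (forall t, D t -> `|h t| <= normc (f t)) ->
    `|\int[mu]_(t in D) h t| <= \int[mu]_(t in D) g t.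
  move=> ih hf; apply: (le_trans (le_normr_Rintegral _ _)) => //.
  apply: le_Rintegral => //; first exact: integrable_norm.
  by move=> t Dt; rewrite (le_trans (hf t Dt))// fg.
by apply: lerD; apply: H => // t Dt; [exact: abs_Re_le|exact: abs_Im_le].
Qed.

Lemma c_integral_mkcond D f :
  c_integral D f = c_integral setT (fun t => if t \in D then f t else 0).
Proof.
by congr Complex; rewrite Rintegral_mkcond; apply: eq_Rintegral => t _;
  rewrite patchE; case: ifPn.
Qed.

End ComplexIntegral.

(** * Affine substitutions in Lebesgue integrals *)

Section AffineSubstitution.
Context {R : realType}.
Local Notation mu := (@lebesgue_measure R).
Local Notation TR := (measurableTypeR R).

Lemma measurable_affine (a b : R) : measurable_fun [set: TR] ((fun t => a * t + b) : TR -> TR).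
Proof. by apply: measurable_funD => //; exact: measurable_cst. Qed.

(** It is enough to compare the two measures on half-open intervals. *)
Lemma lebesgue_measure_affine (a b : R) (A : set TR) : 0 < a -> measurable A ->
  mu A = (a%:E * pushforward mu ((fun t => a * t + b)%R : TR -> TR) A)%E.
Proof.
move=> a0 mA.
pose phi := (fun t => a * t + b)%R : TR -> TR.
pose nu' := mscale (NngNum (ltW a0)) (pushforward mu phi : measure _ _).
pose nu : {measure set TR -> \bar R} := nu' (measurable_affine a b).
rewrite -[RHS]/(nu A).
apply: lebesgue_measure_unique => // _ [[c d]] _ <-.
rewrite /nu /nu' /= /mscale/= /pushforward/=.
have -> : (fun t => a * t + b) @^-1` `]c, d] = `](c - b) / a, (d - b) / a]%classic.
  apply/seteqP; split => t /=; rewrite !in_itv/= ltr_pdivrMr//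
    ler_pdivlMr// ltrBlDr lerBrDr (mulrC t) //.
rewrite !lebesgue_measure_itv/= !lte_fin ltr_pM2r ?invr_gt0// ltrD2r.
case: ifPn => cd; last by rewrite mule0.
by rewrite -!EFinB -EFinM; congr EFin; field; rewrite gt_eqF.
Qed.

(** Positive functions need no integrability, and the signed and complex cases
    reduce to this one. *)
Lemma ge0_integral_affine (a b : R) (f : TR -> \bar R) : 0 < a ->
  measurable_fun setT f -> (forall x, 0 <= f x)%E ->
  (\int[mu]_x f x = a%:E * \int[mu]_x f (a * x + b)%R)%E.
Proof.
move=> a0 mf f0.
pose phi := (fun t => a * t + b)%R : TR -> TR.
pose nu' := mscale (NngNum (ltW a0)) (pushforward mu phi : measure _ _).
pose nu : {measure set TR -> \bar R} := nu' (measurable_affine a b).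
transitivity (\int[nu]_x f x)%E.
  by apply: eq_measure_integral => A mA _; exact: lebesgue_measure_affine.
rewrite /nu /nu' ge0_integral_mscale//=; congr (_ * _)%E.
by rewrite (ge0_integral_pushforward (measurable_affine a b))//.
Qed.

Lemma integrable_affine (a b : R) (f : R -> R) : 0 < a ->
  measurable_fun [set: TR] f ->
  mu.-integrable setT (EFin \o (fun t => f (a * t + b))) ->
  mu.-integrable setT (EFin \o f).
Proof.
move=> a0 mf /integrableP[_ fi]; apply/integrableP; split.
  exact/measurable_EFinP.
rewrite (@ge0_integral_affine a b)//; last first.
  by apply: measurableT_comp => //; exact/measurable_EFinP.
by rewrite lte_mul_pinfty// ?lee_fin ?ltW.
Qed.

Lemma Rintegral_affine (a b : R) (f : R -> R) : 0 < a ->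
  measurable_fun [set: TR] f ->
  mu.-integrable setT (EFin \o (fun t => f (a * t + b))) ->
  \int[mu]_t f t = a * \int[mu]_t f (a * t + b).
Proof.
move=> a0 mf fi; rewrite -RintegralZl//.
rewrite /Rintegral; congr fine.
under [RHS]eq_integral do rewrite EFinM.
have mf' : measurable_fun [set: TR] (EFin \o f) by exact/measurable_EFinP.
rewrite [LHS]integralE integralZl//.
rewrite (@ge0_integral_affine a b _ a0 (measurable_funepos mf'))//.
rewrite (@ge0_integral_affine a b _ a0 (measurable_funeneg mf'))//.
have eqn : (\int[mu]_x (EFin \o f)^\- (a * x + b)%R =
    \int[mu]_x (EFin \o (fun t => f (a * t + b)%R))^\- x)%E.
  by apply: eq_integral => t _; rewrite !funenegE.
have eqp : (\int[mu]_x (EFin \o f)^\+ (a * x + b)%R =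
    \int[mu]_x (EFin \o (fun t => f (a * t + b)%R))^\+ x)%E.
  by apply: eq_integral => t _; rewrite !funeposE.
rewrite eqn eqp -muleBr//; last first.
  apply: fin_num_adde_defl; rewrite fin_numN.
  exact: (integrable_neg_fin_num measurableT fi).
by rewrite [in RHS]integralE.
Qed.

Lemma c_integrable_affine (a b : R) (f : R -> R[i]) : 0 < a ->
  c_measurable [set: TR] f ->
  c_integrable setT (fun t => f (a * t + b)) -> c_integrable setT f.
Proof.
move=> a0 [mr mi] [ir ii].
by split; [apply: integrable_affine ir|apply: integrable_affine ii].
Qed.

Lemma c_integral_affine (a b : R) (f : R -> R[i]) : 0 < a ->
  c_measurable [set: TR] f ->
  c_integrable setT (fun t => f (a * t + b)) ->
  c_integral setT f = a%:C * c_integral setT (fun t => f (a * t + b)).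
Proof.
move=> a0 [mr mi] [ir ii]; apply: complex_eq; rewrite ?cReM ?cImM /= !mul0r ?subr0 ?addr0.
  exact: (Rintegral_affine a0 mr ir).
exact: (Rintegral_affine a0 mi ii).
Qed.

End AffineSubstitution.

(** * Limits of complex sequences, dominated convergence and Fubini *)

Definition c_cvg {R : realType} (s : nat -> R[i]) (L : R[i]) : Prop :=
  (fun k => complex.Re (s k)) @ \oo --> complex.Re L /\
  (fun k => complex.Im (s k)) @ \oo --> complex.Im L.

Section ComplexLimits.
Context {R : realType}.
Implicit Types (s u : nat -> R[i]).

Lemma c_cvg_unique s L L' : c_cvg s L -> c_cvg s L' -> L = L'.
Proof.
move=> [r1 j1] [r2 j2]; apply: complex_eq.
  exact: (cvg_unique (@norm_hausdorff _ _) r1 r2).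
exact: (cvg_unique (@norm_hausdorff _ _) j1 j2).
Qed.

Lemma c_cvg_cst (z : R[i]) : c_cvg (fun=> z) z.
Proof. by split; exact: cvg_cst. Qed.

Lemma c_cvgM s u L M : c_cvg s L -> c_cvg u M -> c_cvg (fun k => s k * u k) (L * M).
Proof.
move=> [rs js] [ru ju]; split.
  under eq_fun do rewrite cReM.
  by rewrite cReM; apply: cvgB; exact: cvgM.
under eq_fun do rewrite cImM.
by rewrite cImM; apply: cvgD; exact: cvgM.
Qed.

Lemma c_cvgD s u L M : c_cvg s L -> c_cvg u M -> c_cvg (fun k => s k + u k) (L + M).
Proof.
move=> [rs js] [ru ju]; split.
  under eq_fun do rewrite cReD.
  by rewrite cReD; exact: cvgD.
under eq_fun do rewrite cImD.
by rewrite cImD; exact: cvgD.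
Qed.

Lemma c_cvg0_le s (e : nat -> R) : (forall k, normc (s k) <= e k) ->
  e @ \oo --> 0 -> c_cvg s 0.
Proof.
move=> se e0; split; apply/norm_cvg0P/(squeeze_cvgr _ (cvg_cst 0) e0);
  apply: nearW => k; rewrite normr_ge0 /=.
- exact: le_trans (abs_Re_le (s k)) (se k).
- exact: le_trans (abs_Im_le (s k)) (se k).
Qed.

(** A geometric majorant is the only form of absolute convergence that the
    Prabhakar series require. *)
Lemma c_cvg_series (a : nat -> R[i]) (C : R) :
  (forall k, normc (a k) <= C * 2^-1 ^+ k) ->
  exists L, c_cvg (fun N => \sum_(0 <= k < N) a k) L.
Proof.
move=> aC.
have gC : cvgn (series (geometric C (2^-1 : R))).
  apply: is_cvg_geometric_series; rewrite ger0_norm; lra.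
have key (b : nat -> R) : (forall k, `|b k| <= C * 2^-1 ^+ k) -> cvgn (series b).
  move=> bC; apply: normed_cvg; apply: series_le_cvg gC => k //=.
  exact: le_trans (normr_ge0 _) (bC k).
have [/cvg_ex[/= x hx] /cvg_ex[/= y hy]] :
  cvgn (series (fun k => complex.Re (a k))) /\ cvgn (series (fun k => complex.Im (a k))).
  split; apply: key => k; apply: le_trans (aC k).
    exact: abs_Re_le.
  exact: abs_Im_le.
have sRe N : complex.Re (\sum_(0 <= k < N) a k) = \sum_(0 <= k < N) complex.Re (a k).
  by elim/big_ind2 : _ => // ? ? ? ? <- <-; rewrite cReD.
have sIm N : complex.Im (\sum_(0 <= k < N) a k) = \sum_(0 <= k < N) complex.Im (a k).
  by elim/big_ind2 : _ => // ? ? ? ? <- <-; rewrite cImD.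
exists (x +i* y); split => /=.
  by under eq_fun do rewrite sRe; exact: hx.
by under eq_fun do rewrite sIm; exact: hy.
Qed.

End ComplexLimits.

Section DominatedConvergence.
Context {R : realType}.
Local Notation mu := (@lebesgue_measure R).
Local Notation TR := (measurableTypeR R).

Let real_dominated (D : set TR) (f_ : nat -> R -> R) (f g : R -> R) :
  measurable D -> (forall k, measurable_fun D (f_ k)) ->
  (forall t, D t -> f_ ^~ t @ \oo --> f t) ->
  mu.-integrable D (EFin \o g) -> (forall k t, D t -> `|f_ k t| <= g t) ->
  mu.-integrable D (EFin \o f) /\
  (fun k => \int[mu]_(t in D) f_ k t) @ \oo --> \int[mu]_(t in D) f t.
Proof.
move=> mD mf_ f_f ig f_g.
have mf : measurable_fun D f by exact: (measurable_fun_cvg mf_ f_f).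
have [ifi _ lim] : [/\ mu.-integrable D (EFin \o f),
  (fun k => \int[mu]_(t in D) `|(f_ k t)%:E - (f t)%:E|)%E @ \oo --> 0%E &
  (fun k => \int[mu]_(t in D) (f_ k t)%:E)%E @ \oo --> (\int[mu]_(t in D) (f t)%:E)%E].
  apply: (@dominated_convergence _ _ _ mu D mD (fun k => EFin \o f_ k) _ (EFin \o g)) => //.
  - by move=> k; exact/measurable_EFinP.
  - exact/measurable_EFinP.
  - by apply: aeW => t Dt /=; apply: cvg_EFin; [exact: nearW|exact: f_f].
  - by apply: aeW => t k Dt /=; rewrite lee_fin f_g.
split => //; rewrite /Rintegral.
by apply: fine_cvg; rewrite fineK//; exact: integrable_fin_num.
Qed.

Lemma c_dominated_convergence (D : set TR) (f_ : nat -> R -> R[i]) (f : R -> R[i])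
    (g : R -> R) :
  measurable D -> (forall k, c_measurable D (f_ k)) ->
  (forall t, D t -> c_cvg (f_ ^~ t) (f t)) ->
  mu.-integrable D (EFin \o g) -> (forall k t, D t -> normc (f_ k t) <= g t) ->
  c_integrable D f /\ c_cvg (fun k => c_integral D (f_ k)) (c_integral D f).
Proof.
move=> mD mf_ f_f ig f_g.
have [ir lr] := real_dominated mD (fun k => (mf_ k).1) (fun t Dt => (f_f t Dt).1) ig
  (fun k t Dt => le_trans (abs_Re_le (f_ k t)) (f_g k t Dt)).
have [ii li] := real_dominated mD (fun k => (mf_ k).2) (fun t Dt => (f_f t Dt).2) ig
  (fun k t Dt => le_trans (abs_Im_le (f_ k t)) (f_g k t Dt)).
by [].
Qed.

End DominatedConvergence.

Section ComplexFubini.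
Context {R : realType}.
Local Notation mu := (@lebesgue_measure R).
Local Notation TR := (measurableTypeR R).

Let real_Fubini (f : TR * TR -> R) : measurable_fun setT f ->
  (\int[mu]_x \int[mu]_y `|f (x, y)|%:E < +oo)%E ->
  (forall x, mu.-integrable setT (fun y => (f (x, y))%:E)) ->
  (forall y, mu.-integrable setT (fun x => (f (x, y))%:E)) ->
  \int[mu]_x \int[mu]_y f (x, y) = \int[mu]_y \int[mu]_x f (x, y).
Proof.
move=> mf fi fx fy.
have int2 : (mu \x mu)%E.-integrable setT (EFin \o f).
  by apply/integrable12ltyP => //; exact/measurable_EFinP.
have := Fubini int2.
rewrite /Rintegral => E; congr fine.
transitivity (\int[mu]_x \int[mu]_y (f (x, y))%:E)%E.
  by apply: eq_integral => x _; rewrite fineK//; apply: integrable_fin_num.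
rewrite E; apply: eq_integral => y _; rewrite fineK//; exact: integrable_fin_num.
Qed.

(** Asking that every section be integrable, and not only almost every one,
    spares all reasoning about null sets: the inner integrals are then finite
    everywhere.  For the Beta-Gamma relation this can be checked directly. *)
Lemma c_Fubini (f : TR * TR -> R[i]) : c_measurable setT f ->
  (\int[mu]_x \int[mu]_y (normc (f (x, y)))%:E < +oo)%E ->
  (forall x, c_integrable setT (fun y => f (x, y))) ->
  (forall y, c_integrable setT (fun x => f (x, y))) ->
  c_integral setT (fun x => c_integral setT (fun y => f (x, y))) =
  c_integral setT (fun y => c_integral setT (fun x => f (x, y))).
Proof.
move=> mf fi fx fy.
have mn : measurable_fun setT (EFin \o (fun z => normc (f z))).
  by apply/measurable_EFinP; exact: measurable_normc.
have dom (h : TR * TR -> R) : measurable_fun setT h -> (forall z, `|h z| <= normc (f z)) ->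
  (\int[mu]_x \int[mu]_y `|h (x, y)|%:E < +oo)%E.
  move=> mh hf; apply: le_lt_trans fi.
  have mh' : measurable_fun setT (EFin \o (fun z => `|h z|)).
    by apply/measurable_EFinP; exact: measurableT_comp.
  apply: ge0_le_integral => //.
  - by move=> x _; apply: integral_ge0 => y _; rewrite lee_fin.
  - apply: (@measurable_fun_fubini_tonelli_F _ _ _ _ _ mu _ mh') => z.
    by rewrite /= lee_fin.
  - apply: (@measurable_fun_fubini_tonelli_F _ _ _ _ _ mu _ mn) => z.
    by rewrite /= lee_fin normc_ge0.
  - move=> x _; apply: ge0_le_integral => //.
    + exact: (measurableT_comp mh').
    + exact: (measurableT_comp mn).
    + by move=> y _; rewrite lee_fin.
case: mf => mr mi; apply: complex_eq.
- apply: (real_Fubini mr); first exact: dom (fun z => abs_Re_le (f z)).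
  + by move=> x; exact: (fx x).1.
  + by move=> x; exact: (fy x).1.
- apply: (real_Fubini mi); first exact: dom (fun z => abs_Im_le (f z)).
  + by move=> x; exact: (fx x).2.
  + by move=> x; exact: (fy x).2.
Qed.

End ComplexFubini.

(** * Gamma and Beta integrals of real arguments, in the extended reals *)

Section RealBeta.
Context {R : realType}.
Local Notation mu := (@lebesgue_measure R).
Local Notation TR := (measurableTypeR R).
Implicit Types a b y t u : R.

(** Extending the power by 0 to the negative half-line makes Euler integrals
    and finite-interval Beta integrals into integrals over the whole line, so
    that translations and the exchange of integrals need no bookkeeping of
    domains. *)
Definition rkernel (y t : R) : R := if 0 < t then t `^ (y - 1) else 0.

Definition rgamma (y : R) : \bar R := (\int[mu]_t (rkernel y t * expR (- t))%:E)%E.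

Definition rbeta (a b : R) : \bar R :=
  (\int[mu]_t (rkernel a (1 - t) * rkernel b t)%:E)%E.

Lemma rkernel_ge0 y t : 0 <= rkernel y t.
Proof. by rewrite /rkernel; case: ifP => // _; exact: powR_ge0. Qed.

Lemma measurable_rkernel y : measurable_fun [set: TR] (rkernel y).
Proof.
apply: measurable_fun_ifT => //; first exact: measurable_fun_ltr.
Qed.

Lemma rkernelM y u t : 0 < u -> rkernel y (u * t) = u `^ (y - 1) * rkernel y t.
Proof.
move=> u0; rewrite /rkernel pmulr_rgt0//; case: ifP => t0; last by rewrite mulr0.
by rewrite powRM// ltW.
Qed.

Lemma measurable_rconv a b u :
  measurable_fun [set: TR] (fun t => rkernel a (u - t) * rkernel b t).
Proof.
apply: measurable_funM; last exact: measurable_rkernel.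
apply: (measurableT_comp (measurable_rkernel a)).
by apply: measurable_funB => //; exact: measurable_cst.
Qed.

Lemma rkernel_conv_le0 a b u t : u <= 0 -> rkernel a (u - t) * rkernel b t = 0.
Proof.
move=> u0; rewrite /rkernel; case: ifP => [|_]; last by rewrite mul0r.
rewrite subr_gt0 => tu; case: ifP => [t0|_]; last by rewrite mulr0.
by have := lt_le_trans (lt_trans t0 tu) u0; rewrite ltxx.
Qed.

(** Scaling t = u s: the convolution of two power kernels is homogeneous, so
    it is determined by its value at 1. *)
Lemma rkernel_conv a b u :
  (\int[mu]_t (rkernel a (u - t) * rkernel b t)%:E = (rkernel (a + b) u)%:E * rbeta a b)%E.
Proof.
have [u0|u0] := ltP 0 u; last first.
  under eq_integral do rewrite rkernel_conv_le0//.
  by rewrite integral0 /rkernel ltNge u0 /= mul0e.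
rewrite (@ge0_integral_affine _ u 0
  (fun t => (rkernel a (u - t) * rkernel b t)%:E)%E u0); last 2 first.
- by apply/measurable_EFinP; exact: measurable_rconv.
- by move=> t; rewrite lee_fin mulr_ge0 ?rkernel_ge0.
have E t : ((rkernel a (u - (u * t + 0)) * rkernel b (u * t + 0))%:E =
    (u `^ (a - 1) * u `^ (b - 1))%:E * (rkernel a (1 - t) * rkernel b t)%:E)%E.
  rewrite addr0 -{1}(mulr1 u) -mulrBr !rkernelM// -EFinM; congr EFin; ring.
under eq_integral do rewrite E.
rewrite ge0_integralZl_EFin//; last 3 first.
- by move=> t _; rewrite lee_fin mulr_ge0 ?rkernel_ge0.
- by apply/measurable_EFinP; exact: measurable_rconv.
- by rewrite mulr_ge0 ?powR_ge0.
rewrite muleA -/(rbeta a b); congr (_ * _)%E; rewrite -EFinM; congr EFin.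
rewrite /rkernel u0 -{1}(powRr1 (ltW u0)) -!powRD; last 2 first.
- by rewrite (gt_eqF u0) implybT.
- by rewrite (gt_eqF u0) implybT.
by congr powR; ring.
Qed.

Lemma rgamma_ge0 y : (0 <= rgamma y)%E.
Proof.
by apply: integral_ge0 => t _; rewrite lee_fin mulr_ge0 ?rkernel_ge0 ?expR_ge0.
Qed.

Lemma rbeta_ge0 a b : (0 <= rbeta a b)%E.
Proof.
by apply: integral_ge0 => t _; rewrite lee_fin mulr_ge0 ?rkernel_ge0.
Qed.

Lemma measurable_gamma_integrand y :
  measurable_fun [set: TR] (fun t => rkernel y t * expR (- t)).
Proof.
apply: measurable_funM; first exact: measurable_rkernel.
by apply: measurableT_comp => //; exact: measurable_funN.
Qed.

Let gamma_integrand_ge0 y t : (0 <= (rkernel y t * expR (- t))%:E)%E.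
Proof. by rewrite lee_fin mulr_ge0 ?rkernel_ge0 ?expR_ge0. Qed.

Let measurable_EFin_gamma_integrand y :
  measurable_fun [set: TR] (fun t => (rkernel y t * expR (- t))%:E).
Proof. by apply/measurable_EFinP; exact: measurable_gamma_integrand. Qed.

Let conv_integrand_ge0 a b t u :
  (0 <= (rkernel a (u - t) * rkernel b t * expR (- u))%:E)%E.
Proof. by rewrite lee_fin !mulr_ge0 ?rkernel_ge0 ?expR_ge0. Qed.

Let measurable_conv_integrand a b : measurable_fun setT (fun z : TR * TR =>
  (rkernel a (z.2 - z.1) * rkernel b z.1 * expR (- z.2))%:E).
Proof.
apply/measurable_EFinP; apply: measurable_funM; [apply: measurable_funM|].
- apply: (measurableT_comp (measurable_rkernel a)).
  by apply: measurable_funB; [exact: measurable_snd|exact: measurable_fst].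
- by apply: (measurableT_comp (measurable_rkernel b)); exact: measurable_fst.
- have me : measurable_fun [set: TR] (fun t : TR => expR (- t)).
    by apply: measurableT_comp => //; exact: measurable_funN.
  exact: (measurableT_comp me measurable_snd).
Qed.

(** Substitute s = u - t in the inner one of the two Euler integrals. *)
Lemma rgammaM_iterated a b : (rgamma a * rgamma b =
  \int[mu]_t \int[mu]_u (rkernel a (u - t) * rkernel b t * expR (- u))%:E)%E.
Proof.
rewrite {2}/rgamma -ge0_integralZl//; last exact: rgamma_ge0.
apply: eq_integral => t _; rewrite muleC -ge0_integralZl//.
rewrite [LHS](@ge0_integral_affine _ 1 (- t))//; last 2 first.
- exact: measurable_funeM.
- by move=> s; rewrite mule_ge0.
rewrite mul1e; apply: eq_integral => u _.
rewrite -EFinM mul1r; congr EFin.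
rewrite (_ : - u = - (u - t) + - t); last by ring.
by rewrite expRD; ring.
Qed.

(** Integrate first in t: the inner integral is a convolution of kernels. *)
Lemma rgammaM a b : (rgamma a * rgamma b = rgamma (a + b) * rbeta a b)%E.
Proof.
have := fubini_tonelli _ (measurable_conv_integrand a b)
  (fun z => conv_integrand_ge0 a b z.1 z.2).
rewrite rgammaM_iterated /= => ->.
rewrite muleC -ge0_integralZl//; last exact: rbeta_ge0.
apply: eq_integral => u _ /=.
under eq_integral do rewrite mulrC EFinM.
rewrite ge0_integralZl_EFin//; last 2 first.
- by move=> t _; rewrite lee_fin mulr_ge0 ?rkernel_ge0.
- by apply/measurable_EFinP; exact: measurable_rconv.
by rewrite rkernel_conv EFinM muleA [RHS]muleC (muleC (expR _)%:E).
Qed.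

End RealBeta.

(** * Finiteness and growth of the real Gamma integral *)

Section RealGammaFinite.
Context {R : realType}.
Local Notation mu := (@lebesgue_measure R).
Local Notation TR := (measurableTypeR R).
Implicit Types a b y t u : R.

Let powR_mass (e y : R) : 0 < y -> 0 < e < 1 ->
  (\int[mu]_(t in `[e, 1%R]) (y * t `^ (y - 1))%:E <= 1)%E.
Proof.
move=> y0 /andP[e0 e1].
have cpow (z x : R) : 0 < x -> {for x, continuous (fun t : R => t `^ z)}.
  move=> x0; apply/differentiable_continuous/derivable1_diffP/derivable_powR.
  by rewrite in_itv/= x0.
rewrite (@continuous_FTC2 _ _ (@powR R ^~ y) e 1 e1).
- by rewrite powR1 -EFinB lee_fin gerBl powR_ge0.
- apply: continuous_in_subspaceT => x; rewrite inE/= in_itv/= => /andP[ex _].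
  have x0 : 0 < x := lt_le_trans e0 ex.
  by apply: cvgM; [exact: cvg_cst|exact: cpow].
- split.
  + move=> x; rewrite in_itv/= => /andP[ex _]; apply: derivable_powR.
    by rewrite in_itv/= (lt_trans e0 ex).
  + exact/cvg_at_right_filter/cpow.
  + exact/cvg_at_left_filter/cpow.
- move=> x; rewrite in_itv/= => /andP[ex _]; rewrite powR_derive1//.
  by rewrite in_itv/= (lt_trans e0 ex).
Qed.

(** The power y t^(y-1) may blow up at 0, so the integral over ]0, 1] is reached
    from the intervals [1/(k+2), 1] by monotone convergence. *)
Let powR_integral01 y : 0 < y ->
  (\int[mu]_t ((if 0 < t <= 1 then y * t `^ (y - 1) else 0)%R)%:E <= 1)%E.
Proof.
move=> y0.
pose g (k : nat) t : \bar R :=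
  ((if k.+2%:R^-1 <= t <= 1 then y * t `^ (y - 1) else 0)%R)%:E.
have g0 k t : (0 <= g k t)%E.
  by rewrite lee_fin; case: ifP => // _; rewrite mulr_ge0 ?powR_ge0// ltW.
have mg k : measurable_fun [set: TR] (g k).
  apply/measurable_EFinP; apply: measurable_fun_ifT => //.
    by apply: measurable_and; apply: measurable_fun_ler.
  by apply: measurable_funM => //; exact: measurable_powR.
have glim t : limn (g ^~ t) = ((if 0 < t <= 1 then y * t `^ (y - 1) else 0)%R)%:E.
  apply: (@cvg_lim) => //; apply: cvg_near_cst.
  have [t0|t0] := ltP 0 t; last first.
    apply: nearW => k; rewrite /g /= leNgt (le_lt_trans t0)//.
  near=> k; rewrite /g /=.
  suff -> : k.+2%:R^-1 <= t by [].
  rewrite invf_ple ?posrE//.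
  near: k; have [N hN] : exists N : nat, t^-1 <= N%:R.
    exists (Num.truncn t^-1).+1; exact/ltW/truncnS_gt.
  exists N => // k /= Nk; rewrite (le_trans hN)// ler_nat (leq_trans Nk)//.
  by rewrite -addn2 leq_addr.
rewrite (@eq_integral _ TR R mu setT (fun t => limn (g ^~ t))); last by move=> t _; rewrite glim.
have nd t : setT t -> {homo g ^~ t : k l / (k <= l)%N >-> (k <= l)%E}.
  move=> _ k l kl; rewrite lee_fin.
  have [/andP[kt t1]|_] := ifPn.
    by rewrite t1 (le_trans _ kt)// lef_pV2 ?posrE// ler_nat !ltnS.
  by case: ifP => // _; rewrite mulr_ge0 ?powR_ge0// ltW.
have hc := cvg_monotone_convergence (mu := mu) (D := setT) measurableT mg (fun k t _ => g0 k t) nd.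
rewrite -(cvg_lim _ hc)//; apply: lime_le; first exact: cvgP hc.
apply: nearW => k.
have k01 : 0 < (k.+2%:R^-1 : R) < 1 by rewrite invr_gt0 ltr0n invf_lt1 ?ltr1n.
apply: le_trans (powR_mass y0 k01).
rewrite le_eqVlt; apply/orP; left; apply/eqP; rewrite [RHS]integral_mkcond.
apply: eq_integral => t _; rewrite patchE mem_setE in_itv /= /g.
by case: ifP.
Unshelve. all: by end_near. Qed.

(** For y <= 1 the integrand is at most t^(y-1) on ]0, 1] and e^(-t) beyond. *)
Lemma rgamma_gt0_le1 y : 0 < y <= 1 -> (rgamma y < +oo)%E.
Proof.
move=> /andP[y0 y1].
have mg : measurable_fun [set: TR] (fun t => ((if 0 < t <= 1 then y * t `^ (y - 1) else 0)%R)%:E).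
  apply/measurable_EFinP; apply: measurable_fun_ifT => //.
    by apply: measurable_and; [apply: measurable_fun_ltr|apply: measurable_fun_ler].
  by apply: measurable_funM => //; exact: measurable_powR.
have g0 t : (0 <= ((if 0 < t <= 1 then y * t `^ (y - 1) else 0)%R)%:E)%E.
  by rewrite lee_fin; case: ifP => // _; rewrite mulr_ge0 ?powR_ge0// ltW.
have me : measurable_fun [set: TR] (fun t => (exponential_pdf 1 t)%:E).
  by apply/measurable_EFinP; exact: measurable_exponential_pdf.
have e0 t : (0 <= (exponential_pdf (1 : R) t)%:E)%E by rewrite lee_fin exponential_pdf_ge0.
have yV : 0 <= y^-1 by rewrite invr_ge0 ltW.
apply: (@le_lt_trans _ _ (y^-1%:E * \int[mu]_t ((if 0 < t <= 1 then y * t `^ (y - 1) else 0)%R)%:E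
   + \int[mu]_t (exponential_pdf 1 t)%:E)%E); last first.
  rewrite integral_exponential_pdf// lte_add_pinfty ?ltry//.
  rewrite lte_mul_pinfty ?lee_fin//.
  exact: le_lt_trans (powR_integral01 y0) (ltry _).
rewrite -ge0_integralZl_EFin// -ge0_integralD//; last 2 first.
- by move=> t _; rewrite mule_ge0.
- exact: measurable_funeM.
apply: ge0_le_integral => //.
- by move=> t _; rewrite lee_fin mulr_ge0 ?rkernel_ge0 ?expR_ge0.
- by apply/measurable_EFinP; exact: measurable_gamma_integrand.
- by apply: emeasurable_funD => //; exact: measurable_funeM.
move=> t _; rewrite -EFinM -EFinD lee_fin /rkernel.
have [t0|t0] := ltP 0 t; last first.
  by rewrite /= mul0r mulr0 add0r exponential_pdf_ge0.
rewrite exponential_pdfE ?(ltW t0)//= mul1r mulN1r; case: ifPn => t1.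
  rewrite mulrA mulVf ?gt_eqF// mul1r -[leLHS]addr0 lerD ?expR_ge0//.
  by rewrite ler_piMr ?powR_ge0// expR_le1 oppr_le0 ltW.
rewrite mulr0 add0r ler_piMl ?expR_ge0// -[leRHS](powRr0 t).
have t1' : 1 <= t by rewrite leNgt; apply: contra t1 => /ltW ->.
by apply: (ler_powR t1'); rewrite subr_le0.
Qed.

(** Keep only the part of the integral over [K, K+1].  With K at one's disposal
    this is growth faster than any geometric sequence in y, and it also shows
    positivity. *)
Lemma rgamma_lower (K y : R) : 1 <= K -> 0 < y ->
  ((K `^ y * (expR (- (K + 1)) / (K + 1)))%:E <= rgamma y)%E.
Proof.
move=> K1 y0.
have K0 : 0 < K by lra.
have mG : measurable_fun [set: TR] (fun t => (rkernel y t * expR (- t))%:E).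
  by apply/measurable_EFinP; exact: measurable_gamma_integrand.
apply: (@le_trans _ _ (\int[mu]_(t in `[K, (K + 1)%R]) (rkernel y t * expR (- t))%:E)%E); last first.
  apply: ge0_subset_integral => // t _.
  by rewrite lee_fin mulr_ge0 ?rkernel_ge0 ?expR_ge0.
set c := K `^ y * _.
have -> : c%:E = (\int[mu]_(t in `[K, (K + 1)%R]) c%:E)%E.
  rewrite integral_cst//= lebesgue_measure_itv /= lte_fin ltrDl ltr01 -EFinB.
  by rewrite addrAC subrr add0r mule1.
apply: ge0_le_integral => //.
- move=> t _; rewrite lee_fin /c !mulr_ge0 ?powR_ge0 ?expR_ge0// invr_ge0; lra.
- exact: measurable_funTS.
move=> t; rewrite /= in_itv/= => /andP[Kt tK].
have t0 : 0 < t by lra.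
rewrite lee_fin /rkernel t0 powRB ?(gt_eqF t0) ?implybT// powRr1 ?(ltW t0)// /c.
rewrite -mulrA [_^-1 * _]mulrC; apply: ler_pM; rewrite ?powR_ge0//.
- by rewrite mulr_ge0 ?expR_ge0// invr_ge0; lra.
- by rewrite ge0_ler_powR ?nnegrE// ltW.
- rewrite ler_pM ?expR_ge0 ?invr_ge0 ?ler_expR ?lerN2//; first lra.
  by rewrite lef_pV2 ?posrE; lra.
Qed.

Lemma rgamma_gt0 y : 0 < y -> (0 < rgamma y)%E.
Proof.
move=> y0; apply: lt_le_trans (rgamma_lower (lexx 1) y0).
rewrite lte_fin mulr_gt0 ?powR_gt0// divr_gt0 ?expR_gt0//; lra.
Qed.

(** Halve y until it is at most 1.  Since B(w/2, w/2) > 0, the relation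
    Gamma(w/2)^2 = Gamma(w) B(w/2, w/2) transfers finiteness from w/2 to w. *)
Lemma rgamma_lty y : 0 < y -> (rgamma y < +oo)%E.
Proof.
move=> y0.
suff H (k : nat) : forall w : R, 0 < w -> w <= k.+1%:R -> (rgamma w < +oo)%E.
  apply: (H (Num.truncn y) y y0); exact/ltW/truncnS_gt.
elim: k => [|k IH] w w0 wk; first by apply: rgamma_gt0_le1; rewrite w0.
have w20 : 0 < w / 2 by lra.
have w2k : (rgamma (w / 2) < +oo)%E.
  apply: IH => //; rewrite ler_pdivrMr// (le_trans wk)// -natrM ler_nat.
  by rewrite mulnC mul2n -addnn addSn ltnS leq_addl.
have := rgammaM (w / 2) (w / 2); rewrite -splitr => E.
have b0 : (0 < rbeta (w / 2) (w / 2))%E.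
  rewrite lt_neqAle rbeta_ge0 andbT; apply/eqP => b0.
  move: E; rewrite -b0 mule0 => /eqP; rewrite mule_eq0 orbb => /eqP g0.
  by have := rgamma_gt0 w20; rewrite g0 ltxx.
rewrite ltNge leye_eq; apply/negP => /eqP gy; move: E; rewrite gy gt0_mulye// => E.
have : (rgamma (w / 2) * rgamma (w / 2) < +oo)%E.
  by rewrite lte_mul_pinfty// ?rgamma_ge0// ge0_fin_numE// rgamma_ge0.
by rewrite E ltxx.
Qed.

(** An infinite Beta integral would make the right-hand side of [rgammaM]
    infinite. *)
Lemma rbeta_lty a b : 0 < a -> 0 < b -> (rbeta a b < +oo)%E.
Proof.
move=> a0 b0; have E := rgammaM a b.
rewrite ltNge leye_eq; apply/negP => /eqP by_; move: E.
rewrite by_ gt0_muley ?rgamma_gt0 ?addr_gt0// => E.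
have : (rgamma a * rgamma b < +oo)%E.
  rewrite lte_mul_pinfty// ?rgamma_ge0 ?rgamma_lty//.
  by rewrite ge0_fin_numE ?rgamma_ge0 ?rgamma_lty.
by rewrite E ltxx.
Qed.

End RealGammaFinite.

(** * Complex Beta integrals and the Beta-Gamma relation *)

Section ComplexBeta.
Context {R : realType}.
Local Notation mu := (@lebesgue_measure R).
Local Notation TR := (measurableTypeR R).
Implicit Types (a b z w : R[i]) (t u : R).

Definition ckernel z t : R[i] := if 0 < t then crpow t (z - 1) else 0.

Definition cbeta a b : R[i] := c_integral setT (fun t => ckernel a (1 - t) * ckernel b t).

Lemma normc_ckernel z t : normc (ckernel z t) = rkernel (complex.Re z) t.
Proof.
rewrite /ckernel /rkernel; case: ifP => t0; last exact: normc0.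
by rewrite normc_crpow// cReB Re1.
Qed.

Lemma c_measurable_crpow z : c_measurable [set: TR] (fun t => crpow t z).
Proof.
have mz (x : R) : measurable_fun [set: TR] (fun t : TR => x * ln t).
  by apply: measurable_funM; [exact: measurable_cst|exact: measurable_ln].
have me (x : R) : measurable_fun [set: TR] (fun t : TR => expR (x * ln t)).
  exact: measurableT_comp.
split.
  under eq_fun do rewrite Re_crpow.
  apply: measurable_funM => //.
  apply: measurableT_comp => //; exact: continuous_measurable_fun (@continuous_cos R).
under eq_fun do rewrite Im_crpow.
apply: measurable_funM => //.
apply: measurableT_comp => //; exact: continuous_measurable_fun (@continuous_sin R).
Qed.

Lemma c_measurable_ckernel z : c_measurable [set: TR] (ckernel z).
Proof.
have [mr mi] := c_measurable_crpow (z - 1).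
split.
  rewrite (_ : (fun _ => _) = fun t => if 0 < t then complex.Re (crpow t (z - 1)) else 0).
    apply: measurable_fun_ifT => //; exact: measurable_fun_ltr.
  by apply/funext => t; rewrite /ckernel; case: ifP.
rewrite (_ : (fun _ => _) = fun t => if 0 < t then complex.Im (crpow t (z - 1)) else 0).
  apply: measurable_fun_ifT => //; exact: measurable_fun_ltr.
by apply/funext => t; rewrite /ckernel; case: ifP.
Qed.

Lemma ckernelM z u t : 0 < u -> ckernel z (u * t) = crpow u (z - 1) * ckernel z t.
Proof.
move=> u0; rewrite /ckernel pmulr_rgt0//; case: ifP => t0; last by rewrite mulr0.
by rewrite crpowM.
Qed.

Lemma c_measurable_conv a b u :
  c_measurable [set: TR] (fun t => ckernel a (u - t) * ckernel b t).
Proof.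
apply: c_measurableM; last exact: c_measurable_ckernel.
apply: (c_measurable_comp (c_measurable_ckernel a)).
by apply: measurable_funB => //; exact: measurable_cst.
Qed.

Lemma integrable_rconv (a b u : R) : 0 < a -> 0 < b ->
  mu.-integrable setT (EFin \o (fun t => rkernel a (u - t) * rkernel b t)).
Proof.
move=> a0 b0; apply/integrableP; split.
  by apply/measurable_EFinP; exact: measurable_rconv.
under eq_integral => t _ do
  rewrite /= ger0_norm ?mulr_ge0 ?rkernel_ge0//.
by rewrite rkernel_conv lte_mul_pinfty ?lee_fin ?rkernel_ge0 ?rbeta_lty.
Qed.

Lemma c_integrable_conv a b u : 0 < complex.Re a -> 0 < complex.Re b ->
  c_integrable setT (fun t => ckernel a (u - t) * ckernel b t).
Proof.
move=> a0 b0; apply: (c_integrable_le _ _ _ (integrable_rconv u a0 b0)) => //.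
  exact: c_measurable_conv.
by move=> t _; rewrite normcM !normc_ckernel.
Qed.

(** Same scaling as in the real case, whose finiteness gives integrability. *)
Lemma ckernel_conv a b u : 0 < complex.Re a -> 0 < complex.Re b ->
  c_integral setT (fun t => ckernel a (u - t) * ckernel b t) =
  ckernel (a + b) u * cbeta a b.
Proof.
move=> a0 b0; have [u0|u0] := ltP 0 u; last first.
  rewrite [X in _ = X * _]/ckernel ltNge u0 /= mul0r -[RHS](c_integral0 setT).
  apply: eq_c_integral => t _; apply: eq0_normc.
  by rewrite normcM !normc_ckernel rkernel_conv_le0.
have E t : ckernel a (u - (u * t + 0)) * ckernel b (u * t + 0) =
    (crpow u (a - 1) * crpow u (b - 1)) * (ckernel a (1 - t) * ckernel b t).
  rewrite addr0 -{1}(mulr1 u) -mulrBr !ckernelM//; ring.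
have ifu : c_integrable setT
    (fun t => ckernel a (u - (u * t + 0)) * ckernel b (u * t + 0)).
  under eq_fun do rewrite E.
  by apply: c_integrableZ => //; exact: c_integrable_conv.
rewrite (c_integral_affine u0 (c_measurable_conv a b u) ifu).
under [X in _ * X = _]eq_c_integral do rewrite E.
rewrite c_integralZ//; last exact: c_integrable_conv.
rewrite mulrA; congr (_ * _).
have -> : u%:C = crpow u 1.
  apply: complex_eq; rewrite ?Re_crpow ?Im_crpow /= mul1r mul0r lnK ?posrE//.
    by rewrite cos0 mulr1.
  by rewrite sin0 mulr0.
by rewrite -!crpowD /ckernel u0; congr crpow; ring.
Qed.

Lemma c_measurable_gamma_integrand z :
  c_measurable [set: TR] (fun t => ckernel z t * (expR (- t))%:C).
Proof.
apply: c_measurableM; first exact: c_measurable_ckernel.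
apply: c_measurable_real; apply: measurableT_comp => //; exact: measurable_funN.
Qed.

Lemma normc_gamma_integrand z t :
  normc (ckernel z t * (expR (- t))%:C) = rkernel (complex.Re z) t * expR (- t).
Proof. by rewrite normcM normc_ckernel normc_real ger0_norm ?expR_ge0. Qed.

Lemma integrable_rgamma (y : R) : 0 < y ->
  mu.-integrable setT (EFin \o (fun t => rkernel y t * expR (- t))).
Proof.
move=> y0; apply/integrableP; split.
  by apply/measurable_EFinP; exact: measurable_gamma_integrand.
under eq_integral => t _ do
  rewrite /= ger0_norm ?mulr_ge0 ?rkernel_ge0 ?expR_ge0//.
exact: rgamma_lty.
Qed.

Lemma c_integrable_gamma z : 0 < complex.Re z ->
  c_integrable setT (fun t => ckernel z t * (expR (- t))%:C).
Proof.
move=> z0; apply: (c_integrable_le _ _ _ (integrable_rgamma z0)) => //.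
  exact: c_measurable_gamma_integrand.
by move=> t _; rewrite normc_gamma_integrand.
Qed.

Lemma euler_integralE z :
  euler_integral z = c_integral setT (fun t => ckernel z t * (expR (- t))%:C).
Proof.
rewrite /euler_integral c_integral_mkcond; apply: eq_c_integral => t _.
by rewrite mem_setE in_itv/= andbT /ckernel; case: ifP => // _; rewrite mul0r.
Qed.

(** The modulus of the two-variable integrand is the integrand of the real
    case with arguments Re a and Re b, hence Fubini's theorem applies. *)
Lemma euler_integralM a b : 0 < complex.Re a -> 0 < complex.Re b ->
  euler_integral a * euler_integral b = euler_integral (a + b) * cbeta a b.
Proof.
move=> a0 b0.
have ab0 : 0 < complex.Re (a + b) by rewrite cReD addr_gt0.
pose h (z : TR * TR) : R[i] :=
  ckernel a (z.2 - z.1) * ckernel b z.1 * (expR (- z.2))%:C.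
have mh : c_measurable setT h.
  apply: c_measurableM; [apply: c_measurableM|].
  - apply: (c_measurable_comp (c_measurable_ckernel a)).
    by apply: measurable_funB; [exact: measurable_snd|exact: measurable_fst].
  - by apply: (c_measurable_comp (c_measurable_ckernel b)); exact: measurable_fst.
  - apply: c_measurable_real.
    have me : measurable_fun [set: TR] (fun t : TR => expR (- t)).
      by apply: measurableT_comp => //; exact: measurable_funN.
    exact: (measurableT_comp me measurable_snd).
have sec1 t u : h (t, 1 * u + t) =
    (ckernel b t * (expR (- t))%:C) * (ckernel a u * (expR (- u))%:C).
  rewrite /h /= mul1r addrK opprD expRD rmorphM /=; ring.
have sec2 u t : h (t, u) = (expR (- u))%:C * (ckernel a (u - t) * ckernel b t).
  by rewrite /h /= mulrC.
have msec t : c_measurable [set: TR] (fun u => h (t, u)).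
  exact: (c_measurable_comp mh).
have ih1' t : c_integrable setT (fun u => h (t, 1 * u + t)).
  under eq_fun do rewrite sec1.
  by apply: c_integrableZ => //; exact: c_integrable_gamma.
have ih1 t : c_integrable setT (fun u => h (t, u)).
  exact: (c_integrable_affine ltr01 (msec t) (ih1' t)).
have ih2 u : c_integrable setT (fun t => h (t, u)).
  under eq_fun do rewrite sec2.
  by apply: c_integrableZ => //; exact: c_integrable_conv.
have fin : (\int[mu]_t \int[mu]_u (normc (h (t, u)))%:E < +oo)%E.
  have <- : (rgamma (complex.Re a) * rgamma (complex.Re b) =
      \int[mu]_t \int[mu]_u (normc (h (t, u)))%:E)%E.
    rewrite rgammaM_iterated; apply: eq_integral => t _; apply: eq_integral => u _.
    by rewrite /h !normcM !normc_ckernel normc_real ger0_norm ?expR_ge0.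
  by rewrite lte_mul_pinfty ?rgamma_ge0 ?rgamma_lty// ge0_fin_numE ?rgamma_ge0 ?rgamma_lty.
have <- : c_integral setT (fun t => c_integral setT (fun u => h (t, u))) =
    euler_integral a * euler_integral b.
  rewrite !euler_integralE -c_integralZ//; last exact: c_integrable_gamma.
  apply: eq_c_integral => t _.
  rewrite (c_integral_affine ltr01 (msec t) (ih1' t)) mul1r.
  under eq_c_integral do rewrite sec1.
  rewrite [RHS]mulrC; apply: c_integralZ => //; exact: c_integrable_gamma.
rewrite (c_Fubini mh fin ih1 ih2) euler_integralE mulrC -c_integralZ//; last first.
  exact: c_integrable_gamma.
apply: eq_c_integral => u _.
under eq_c_integral do rewrite sec2.
rewrite c_integralZ//; last exact: c_integrable_conv.
by rewrite ckernel_conv//; ring.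
Qed.

Lemma normc_cbeta_le a b : 0 < complex.Re a -> 0 < complex.Re b ->
  normc (cbeta a b) <= 2 * fine (rbeta (complex.Re a) (complex.Re b)).
Proof.
move=> a0 b0; apply: normc_c_integral_le => //.
- exact: c_integrable_conv.
- exact: integrable_rconv.
- by move=> t _; rewrite normcM !normc_ckernel.
Qed.

End ComplexBeta.

(** * Non-vanishing of Gamma and a lower bound along arithmetic progressions *)

Section GammaLowerBound.
Context {R : realType}.
Local Notation mu := (@lebesgue_measure R).
Local Notation TR := (measurableTypeR R).
Implicit Types (a b z w : R[i]) (t u : R).

Lemma ckernel1 t : ckernel 1 t = (0 < t)%R%:R :> R[i].
Proof. by rewrite /ckernel subrr crpow0; case: ifP. Qed.

(** Up to the factor u^w, B(1, w) is the integral of t^(w-1) over ]0, u[, for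
    every u > 0.  If B(1, w) = 0, the integral over [1, u[ vanishes for every
    u; but the real part of t^(w-1) is positive near t = 1. *)
Lemma cbeta1_neq0 w : 0 < complex.Re w -> cbeta 1 w != 0.
Proof.
move=> w0; apply/eqP => B0.
pose b := complex.Im w.
(* With this u, the argument of t^(w-1) stays in [-1, 1] when 1 <= t < u. *)
pose u := expR (1 + `|b|)^-1.
have b1 : 0 < 1 + `|b| by rewrite ltr_pwDl.
have u1 : 1 < u by rewrite expR_gt1 invr_gt0.
have u0 : 0 < u by exact: lt_trans u1.
(* f v is t^(w-1) on ]0, v[ and 0 elsewhere. *)
pose f v t := ckernel 1 (v - t) * ckernel w t.
have if_ v : c_integrable setT (f v) by apply: c_integrable_conv.
have f0 v : c_integral setT (f v) = 0.
  by rewrite ckernel_conv// B0 mulr0.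
pose g t := f u t + (-1) * f 1 t.
have ig : c_integrable setT g.
  by apply: c_integrableD => //; exact: c_integrableZ.
have g0 : c_integral setT g = 0.
  by rewrite c_integralD ?c_integralZ ?f0 ?mulr0 ?addr0//; exact: c_integrableZ.
pose c := expR (- ln u) * cos 1.
have c0 : 0 < c by rewrite mulr_gt0 ?expR_gt0 ?cos1_gt0.
have gE t : complex.Re (g t) =
    if 1 <= t < u then complex.Re (crpow t (w - 1)) else 0.
  rewrite /g /f !ckernel1 !subr_gt0 mulN1r -mulrBl /ckernel.
  have [t0|t0] := ltP 0 t; last by rewrite mulr0 leNgt (le_lt_trans t0)//.
  have [t1|t1] := ltP t 1.
    by rewrite (lt_trans t1 u1) subrr mul0r.
  by case: (t < u); rewrite ?mulr1n ?mulr0n subr0 ?mul1r ?mul0r.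
have gc t : 1 <= t < u -> c <= complex.Re (g t).
  move=> tu; rewrite gE tu Re_crpow; move: tu => /andP[t1 tu].
  have t0 : 0 < t by lra.
  have lt0 : 0 <= ln t by rewrite ln_ge0.
  have ltu : ln t <= ln u by rewrite ler_ln ?posrE// ltW.
  have bl : `|complex.Im (w - 1) * ln t| <= 1.
    rewrite cImB /= subr0 normrM (ger0_norm lt0) (le_trans (ler_wpM2l _ ltu))//.
    by rewrite /u expRK ler_pdivrMr// mul1r lerDr.
  apply: ler_pM; [exact: expR_ge0|exact/ltW/cos1_gt0| |].
    rewrite ler_expR cReB /=; nra.
  have cos_abs (x : R) : cos `|x| = cos x.
    by case: (ger0P x) => _; rewrite ?cosN.
  have p2 := @pi_ge2 R.
  rewrite -[leRHS]cos_abs leNgt ltr_cos ?in_itv/= -?leNgt//.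
    by rewrite ler01 (le_trans _ p2)// ler1n.
  by rewrite normr_ge0 (le_trans bl)// (le_trans _ p2)// ler1n.
have : (\int[mu]_t (complex.Re (g t))%:E = 0)%E.
  rewrite -[LHS]fineK; last exact: (integrable_fin_num measurableT ig.1).
  by congr EFin; have := congr1 (@complex.Re R) g0.
apply/eqP; rewrite gt_eqF//.
have mg : measurable_fun [set: TR] (fun t => (complex.Re (g t))%:E).
  by have /measurable_int := ig.1.
have pg t : (0 <= (complex.Re (g t))%:E)%E.
  rewrite lee_fin; have [tu|tu] := boolP (1 <= t < u).
    exact: le_trans (ltW c0) (gc _ tu).
  by rewrite gE (negbTE tu).
apply: (@lt_le_trans _ _ (\int[mu]_(t in `[1%R, u[) (complex.Re (g t))%:E)%E); last first.
  by apply: ge0_subset_integral.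
apply: (@lt_le_trans _ _ (\int[mu]_(t in `[1%R, u[) c%:E)%E).
  rewrite integral_cst//= lebesgue_measure_itv /= lte_fin u1 -EFinB -EFinM lte_fin.
  by rewrite mulr_gt0// subr_gt0.
apply: ge0_le_integral => //.
- by move=> t _; rewrite lee_fin ltW.
- exact: measurable_funTS.
Qed.

Lemma euler_integral1_neq0 : euler_integral (1 : R[i]) != 0.
Proof.
apply/eqP => e0.
have : complex.Re (euler_integral (1 : R[i])) = fine (rgamma 1).
  rewrite euler_integralE /= /Rintegral; congr fine; apply: eq_integral => t _.
  congr EFin; rewrite cReM /= mulr0 subr0; congr (_ * _).
  by rewrite ckernel1 /rkernel subrr powRr0; case: ifP.
rewrite e0 /= => /esym; apply/eqP; rewrite gt_eqF// fine_gt0//.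
by rewrite rgamma_gt0 ?rgamma_lty.
Qed.

Lemma euler_integral_eq0_div w (k : nat) : 0 < complex.Re w ->
  euler_integral (w * k.+1%:R) = 0 -> euler_integral w = 0.
Proof.
move=> w0; elim: k => [|k IH]; first by rewrite mulr1.
rewrite -addn1 natrD mulrDr mulr1 => e0.
have k0 : 0 < complex.Re (w * k.+1%:R) by rewrite ReMnatr mulr_gt0.
have := euler_integralM k0 w0; rewrite e0 mul0r => /eqP.
by rewrite mulf_eq0 => /orP[/eqP/IH|/eqP].
Qed.

(** Pointwise limit behind Gamma(1 + z/k) -> Gamma(1). *)
Lemma crpow_harmonic_cvg t z :
  c_cvg (fun k => crpow t (z * ((k.+1%:R : R)^-1)%:C)) 1.
Proof.
have h (x : R) : (fun k : nat => x * k.+1%:R^-1 * ln t) @ \oo --> 0.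
  rewrite -[X in _ --> X](mul0r (ln t)); apply: cvgM; last exact: cvg_cst.
  rewrite -[X in _ --> X](mulr0 x); apply: cvgM; first exact: cvg_cst.
  exact: cvg_harmonic.
have e1 : (fun k : nat => expR (complex.Re z * k.+1%:R^-1 * ln t)) @ \oo --> (1 : R).
  have := cvg_comp _ _ (h (complex.Re z)) (@continuous_expR R 0).
  by rewrite expR0.
have e2 : (fun k : nat => cos (complex.Im z * k.+1%:R^-1 * ln t)) @ \oo --> (1 : R).
  have := cvg_comp _ _ (h (complex.Im z)) (@continuous_cos R 0).
  by rewrite cos0.
have e3 : (fun k : nat => sin (complex.Im z * k.+1%:R^-1 * ln t)) @ \oo --> (0 : R).
  have := cvg_comp _ _ (h (complex.Im z)) (@continuous_sin R 0).
  by rewrite sin0.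
have rE : (fun k => complex.Re (crpow t (z * ((k.+1%:R : R)^-1)%:C))) =
    (fun k => expR (complex.Re z * k.+1%:R^-1 * ln t) * cos (complex.Im z * k.+1%:R^-1 * ln t)).
  by apply/funext => k; rewrite Re_crpow cReM cImM /= !mulr0 subr0 add0r.
have iE : (fun k => complex.Im (crpow t (z * ((k.+1%:R : R)^-1)%:C))) =
    (fun k => expR (complex.Re z * k.+1%:R^-1 * ln t) * sin (complex.Im z * k.+1%:R^-1 * ln t)).
  by apply/funext => k; rewrite Im_crpow cReM cImM /= !mulr0 subr0 add0r.
rewrite /c_cvg rE iE [complex.Re 1]/= [complex.Im 1]/=; split.
  by rewrite [X in _ --> X](_ : 1 = 1 * 1 :> R); [exact: cvgM|rewrite mulr1].
by rewrite [X in _ --> X](_ : 0 = 1 * 0 :> R); [exact: cvgM|rewrite mulr0].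
Qed.

Lemma euler_integral_harmonic_cvg z : 0 < complex.Re z ->
  c_cvg (fun k => euler_integral (1 + z * ((k.+1%:R : R)^-1)%:C)) (euler_integral 1).
Proof.
move=> z0; rewrite euler_integralE; under eq_fun do rewrite euler_integralE.
(* For 0 < e <= 1, t^(e Re z) is at most 1 + t^(Re z). *)
have ig : mu.-integrable setT (EFin \o
  (fun t => rkernel 1 t * expR (- t) + rkernel (1 + complex.Re z) t * expR (- t))).
  have := integrableD measurableT (integrable_rgamma (ltr01 : 0 < (1 : R)))
    (integrable_rgamma (_ : 0 < 1 + complex.Re z)).
  by apply; rewrite addr_gt0.
pose f (k : nat) t := ckernel (1 + z * ((k.+1%:R : R)^-1)%:C) t * (expR (- t))%:C.
suff [_] : c_integrable setT (fun t => ckernel 1 t * (expR (- t))%:C) /\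
  c_cvg (fun k => c_integral setT (f k))
    (c_integral setT (fun t => ckernel 1 t * (expR (- t))%:C)) by [].
apply: c_dominated_convergence ig _; rewrite /f => //.
- by move=> k; exact: c_measurable_gamma_integrand.
- move=> t _; apply: c_cvgM; last exact: c_cvg_cst.
  rewrite /ckernel; case: ifP => _; last exact: c_cvg_cst.
  rewrite subrr crpow0; under eq_fun do rewrite addrAC subrr add0r.
  exact: crpow_harmonic_cvg.
- move=> k t _; rewrite normc_gamma_integrand -mulrDl ler_wpM2r ?expR_ge0//.
  rewrite cReD cReM /= mulr0 subr0 /rkernel; case: ifPn => t0; last by rewrite addr0.
  rewrite subrr powRr0 ![1 + _ - 1]addrAC subrr !add0r.
  have [t1|t1] := leP t 1.
    rewrite -[leLHS]addr0 lerD ?powR_ge0// -[leRHS](powRr0 t).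
    by apply: ger_powR; rewrite ?t0// mulr_ge0 ?invr_ge0// ltW.
  rewrite -[leLHS]add0r lerD//; apply: (ler_powR (ltW t1)).
  by rewrite ler_piMr ?(ltW z0)// invf_le1 ?ler1n.
Qed.

(** If Gamma(z) = 0 then Gamma vanishes at w = z/k, and
    Gamma(1) Gamma(w) = Gamma(1 + w) B(1, w) makes it vanish at 1 + w as well,
    because B(1, w) <> 0; this contradicts the limit Gamma(1) as k grows. *)
Lemma euler_integral_neq0 z : 0 < complex.Re z -> euler_integral z != 0.
Proof.
move=> z0; apply/eqP => e0.
have key k : euler_integral (1 + z * ((k.+1%:R : R)^-1)%:C) = 0.
  set w := z * _.
  have w0 : 0 < complex.Re w by rewrite cReM /= mulr0 subr0 mulr_gt0 ?invr_gt0.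
  have ew : euler_integral w = 0.
    apply: (@euler_integral_eq0_div _ k) => //.
    suff -> : w * k.+1%:R = z by [].
    rewrite /w -mulrA -(rmorph_nat (real_complex R)) -rmorphM /= mulVf ?pnatr_eq0//.
    by rewrite rmorph1 mulr1.
  have := euler_integralM (ltr01 : 0 < complex.Re (1 : R[i])) w0.
  rewrite ew mulr0 => /esym/eqP; rewrite mulf_eq0 (negbTE (cbeta1_neq0 w0)) orbF.
  by move/eqP.
have := euler_integral_harmonic_cvg z0.
under eq_fun do rewrite key.
move=> /(c_cvg_unique (c_cvg_cst 0)) /esym/eqP.
by rewrite (negbTE euler_integral1_neq0).
Qed.

(** The ratio is positive and almost supermultiplicative, and this alone
    controls the modulus of Gamma off the real axis. *)
Definition gamma_ratio z : R := normc (euler_integral z) / fine (rgamma (complex.Re z)).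

Let fine_rgamma_gt0 (y : R) : 0 < y -> 0 < fine (rgamma y).
Proof. by move=> y0; rewrite fine_gt0// rgamma_gt0 ?rgamma_lty. Qed.

Let rgamma_fin (y : R) : 0 < y -> rgamma y \is a fin_num.
Proof. by move=> y0; rewrite ge0_fin_numE ?rgamma_ge0 ?rgamma_lty. Qed.

Let fine_rgammaM (a b : R) : 0 < a -> 0 < b ->
  fine (rgamma a) * fine (rgamma b) = fine (rgamma (a + b)) * fine (rbeta a b).
Proof.
move=> a0 b0; have ab0 := addr_gt0 a0 b0.
have := congr1 fine (rgammaM a b).
rewrite fineM; [|exact: rgamma_fin..].
move=> ->; apply: fineM; first exact: rgamma_fin.
by rewrite ge0_fin_numE ?rbeta_ge0 ?rbeta_lty.
Qed.

Lemma gamma_ratio_gt0 z : 0 < complex.Re z -> 0 < gamma_ratio z.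
Proof.
move=> z0; rewrite divr_gt0 ?fine_rgamma_gt0// normc_gt0.
exact: euler_integral_neq0.
Qed.

Let ratio_le (Ga Gb Gab B na nb nab nB : R) : 0 < Ga -> 0 < Gb -> 0 < Gab ->
  Ga * Gb = Gab * B -> na * nb = nab * nB -> nB <= 2 * B -> 0 <= nab ->
  na / Ga * (nb / Gb) <= 2 * (nab / Gab).
Proof.
move=> Ga0 Gb0 Gab0 E E' hB n0.
rewrite mulf_div E' E mulrA ler_pdivlMr// mulrAC ler_pdivrMr; last first.
  by rewrite -E mulr_gt0.
have := mulr_ge0 (mulr_ge0 n0 (ltW Gab0)) (_ : 0 <= 2 * B - nB).
by rewrite subr_ge0 => /(_ hB); nra.
Qed.

(** Divide the Beta-Gamma relations at (a, b) and at (Re a, Re b). *)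
Lemma gamma_ratioM a b : 0 < complex.Re a -> 0 < complex.Re b ->
  gamma_ratio a * gamma_ratio b <= 2 * gamma_ratio (a + b).
Proof.
move=> a0 b0; rewrite /gamma_ratio cReD; have ab0 := addr_gt0 a0 b0.
apply: (ratio_le (fine_rgamma_gt0 a0) (fine_rgamma_gt0 b0) (fine_rgamma_gt0 ab0)
  (fine_rgammaM a0 b0) _ (normc_cbeta_le a0 b0)); last exact: normc_ge0.
by rewrite -!normcM euler_integralM.
Qed.

Lemma gamma_ratio_affine_ge z w (k : nat) : 0 < complex.Re z -> 0 < complex.Re w ->
  gamma_ratio w * (gamma_ratio z / 2) ^+ k <= gamma_ratio (z * k%:R + w).
Proof.
move=> z0 w0; elim: k => [|k IH]; first by rewrite mulr0 add0r expr0 mulr1.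
have k0 : 0 < complex.Re (z * k%:R + w).
  by rewrite cReD ReMnatr ltr_wpDl// mulr_ge0// ltW.
rewrite -(addn1 k) natrD mulrDr mulr1 [_ + z]addrC -addrA.
have h2 : 0 <= gamma_ratio z / 2 := divr_ge0 (ltW (gamma_ratio_gt0 z0)) (ler0n _ 2).
apply: (@le_trans _ _ (gamma_ratio z / 2 * gamma_ratio (z * k%:R + w))).
  rewrite addn1 exprS mulrCA; exact: ler_wpM2l h2 _ _ IH.
rewrite mulrAC ler_pdivrMr; last exact: ltr0n.
by rewrite [leRHS]mulrC; exact: gamma_ratioM.
Qed.

(** The loss d^k of [gamma_ratio_affine_ge], with d = rho(z)/2, and the factor
    c^k are both absorbed by choosing K in [rgamma_lower] with
    K^(Re z) >= 2c/d. *)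
Lemma geometric_inv_euler_integral_le z w (c : R) : 0 < complex.Re z -> 0 < complex.Re w ->
  0 <= c -> exists2 C : R, 0 < C & forall k : nat,
    c ^+ k / normc (euler_integral (z * k%:R + w)) <= C * 2^-1 ^+ k.
Proof.
move=> z0 w0 c0.
pose d := gamma_ratio z / 2.
have d0 : 0 < d by rewrite divr_gt0 ?gamma_ratio_gt0.
(* x^(Re z) = 2c/d, and adding 1 ensures K >= 1. *)
pose x := (2 * c / d) `^ (complex.Re z)^-1.
have x0 : 0 <= x by exact: powR_ge0.
pose K := 1 + x.
have K1 : 1 <= K by rewrite lerDl.
have K0 : 0 < K by lra.
pose cK := expR (- (K + 1)) / (K + 1).
have cK0 : 0 < cK by rewrite divr_gt0 ?expR_gt0//; lra.
have y0 : 0 <= 2 * c / d.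
  by apply: divr_ge0; [apply: mulr_ge0|exact: ltW].
have KP : 2 * c / d <= K `^ complex.Re z.
  have -> : 2 * c / d = x `^ complex.Re z.
    by rewrite /x -powRrM mulVf ?gt_eqF// powRr1.
  by apply: (ge0_ler_powR (ltW z0)); rewrite ?nnegrE ?(ltW K0)// lerDr.
pose e := gamma_ratio w * cK.
have e0 : 0 < e by rewrite mulr_gt0 ?gamma_ratio_gt0.
exists e^-1; first by rewrite invr_gt0.
move=> k; set v := z * k%:R + w.
have v0 : 0 < complex.Re v by rewrite cReD ReMnatr ltr_wpDl// mulr_ge0// ltW.
have n0 : 0 < normc (euler_integral v) by rewrite normc_gt0 euler_integral_neq0.
rewrite ler_pdivrMr//.
have low : e * (2 * c) ^+ k <= normc (euler_integral v).
  have H1 := gamma_ratio_affine_ge k z0 w0.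
  have H2 : K `^ (complex.Re v) * cK <= fine (rgamma (complex.Re v)).
    rewrite -lee_fin fineK; last by rewrite ge0_fin_numE ?rgamma_ge0 ?rgamma_lty.
    exact: rgamma_lower.
  have H3 : (2 * c / d) ^+ k <= K `^ complex.Re v.
    rewrite cReD ReMnatr powRD ?(gt_eqF K0) ?implybT// powRrM powR_mulrn ?powR_ge0//.
    rewrite -[leLHS]mulr1 ler_pM//.
    - exact: exprn_ge0.
    - by rewrite lerXn2r ?nnegrE ?powR_ge0.
    - by rewrite -(powRr0 K) ler_powR// ltW.
  have -> : normc (euler_integral v) = gamma_ratio v * fine (rgamma (complex.Re v)).
    by rewrite /gamma_ratio divfK// gt_eqF ?fine_rgamma_gt0.
  have -> : e * (2 * c) ^+ k = (gamma_ratio w * d ^+ k) * ((2 * c / d) ^+ k * cK).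
    have dk0 : d ^+ k != 0 by rewrite expf_neq0 ?gt_eqF.
    rewrite (expr_div_n (2 * c)) /e; move: dk0; move: (d ^+ k) ((2 * c) ^+ k) => D P D0.
    by field.
  apply: ler_pM; last 1 first.
  - by apply: le_trans H2; apply: ler_wpM2r => //; exact: ltW.
  - apply: mulr_ge0; first exact/ltW/gamma_ratio_gt0.
    by apply: exprn_ge0; exact: ltW.
  - by apply: mulr_ge0; [exact: exprn_ge0|exact: ltW].
  - exact: H1.
have -> : c ^+ k = e^-1 * 2^-1 ^+ k * (e * (2 * c) ^+ k).
  rewrite exprMn exprVn; field; by rewrite expf_neq0// gt_eqF.
by rewrite ler_wpM2l// mulr_ge0 ?exprn_ge0// invr_ge0 ltW.
Qed.

End GammaLowerBound.

(** * Pochhammer symbols and the Chu-Vandermonde identity *)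

Section Pochhammer.

Lemma pochhammer0 (A : pzRingType) (l : A) : pochhammer l 0 = 1.
Proof. by rewrite /pochhammer big_ord0. Qed.

Lemma pochhammerS (A : pzRingType) (l : A) (k : nat) :
  pochhammer l k.+1 = pochhammer l k * (l + k%:R).
Proof. by rewrite /pochhammer big_ord_recr. Qed.

(** The coefficient of X^k in the power series of (1 - X)^(-l). *)
Definition binom_coef (F : numFieldType) (l : F) (k : nat) : F := pochhammer l k / k`!%:R.

Lemma binom_coefS (F : numFieldType) (l : F) (k : nat) :
  k.+1%:R * binom_coef l k.+1 = (l + k%:R) * binom_coef l k.
Proof.
rewrite /binom_coef pochhammerS factS natrM.
have k0 : k.+1%:R != 0 :> F by rewrite pnatr_eq0.
have f0 : k`!%:R != 0 :> F by rewrite pnatr_eq0 -lt0n fact_gt0.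
move: k0 f0; move: (k.+1%:R : F) (k`!%:R : F) => x y x0 y0; field.
by rewrite x0 y0.
Qed.

(** Both sides satisfy (k+1) c_(k+1) = (a+b+k) c_k; on the right, split the
    factor k+1 of a diagonal term as i + (k+1-i) and let each part act on its
    own coefficient. *)
Lemma binom_coef_Vandermonde (F : numFieldType) (a b : F) (k : nat) :
  binom_coef (a + b) k = \sum_(i < k.+1) binom_coef a i * binom_coef b (k - i).
Proof.
elim: k => [|k IH].
  by rewrite big_ord1 /binom_coef !pochhammer0 !divr1 mulr1.
have k0 : k.+1%:R != 0 :> F by rewrite pnatr_eq0.
apply: (mulfI k0); rewrite binom_coefS IH !mulr_sumr.
transitivity (\sum_(i < k.+2) i%:R * (binom_coef a i * binom_coef b (k.+1 - i)) +
    \sum_(i < k.+2) (k.+1 - i)%:R * (binom_coef a i * binom_coef b (k.+1 - i))).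
  rewrite [X in _ = X + _]big_ord_recl /= ?mulr0n mul0r add0r.
  rewrite [X in _ = _ + X]big_ord_recr /= subnn ?mulr0n mul0r addr0.
  rewrite -big_split; apply: eq_bigr => i _ /=.
  have ik : (i <= k)%N by rewrite -ltnS.
  rewrite /bump add1n subSS subSn// [X in _ = X + _]mulrA binom_coefS.
  rewrite [X in _ = _ + X]mulrCA binom_coefS natrB//; ring.
rewrite -big_split; apply: eq_bigr => i _ /=.
have ik : (i <= k.+1)%N by rewrite -ltnS.
by rewrite -mulrDl -natrD subnKC.
Qed.

End Pochhammer.

(** * Square and triangular partial sums of a double series *)

Section DoubleSums.

Lemma sum_triangle (V : nmodType) (H : nat -> nat -> V) (N : nat) :
  \sum_(p < N) \sum_(q < N - p) H p q = \sum_(k < N) \sum_(p < k.+1) H p (k - p)%N.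
Proof.
elim: N => [|N IH]; first by rewrite !big_ord0.
rewrite [RHS]big_ord_recr -IH /= !big_ord_recr /= subSn// subnn big_ord1 addrA.
congr (_ + _); rewrite -big_split /=; apply: eq_bigr => p _.
by rewrite subSn ?big_ord_recr//= ltnW.
Qed.

Lemma sum_square (V : nmodType) (H : nat -> nat -> V) (N : nat) :
  \sum_(z : 'I_N * 'I_N) H z.1 z.2 =
  \sum_(k < N) \sum_(p < k.+1) H p (k - p)%N +
  \sum_(z : 'I_N * 'I_N | (N <= z.1 + z.2)%N) H z.1 z.2.
Proof.
rewrite (bigID (fun z : 'I_N * 'I_N => (z.1 + z.2 < N)%N)) /=; congr (_ + _); last first.
  by apply: eq_bigl => z; rewrite -leqNgt.
rewrite -sum_triangle -(pair_big_dep xpredT (fun p q : 'I_N => p + q < N)%N (fun p q => H p q)) /=.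
apply: eq_bigr => p _; rewrite [RHS](big_ord_widen N (H p)) ?leq_subr//.
by apply: eq_bigl => q; rewrite ltn_subRL.
Qed.

End DoubleSums.

(** * The complex Prabhakar series *)

Section PrabhakarSeries.
Context {R : realType}.
Implicit Types (l m n z w r : R[i]).

(** Each factor |l+k|/(k+1) is at most |l|+1. *)
Lemma normc_binom_coef_le l (k : nat) : normc (binom_coef l k) <= (normc l + 1) ^+ k.
Proof.
elim: k => [|k IH]; first by rewrite /binom_coef pochhammer0 divr1 normc1 expr0.
have k0 : 0 < k.+1%:R :> R by rewrite ltr0n.
have := congr1 (@normc R) (binom_coefS l k); rewrite normcM (normcM (l + k%:R)) normc_natr => E.
rewrite -(ler_pM2l k0) E exprS mulrA.
apply: ler_pM; [exact: normc_ge0|exact: normc_ge0| |exact: IH].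
rewrite (le_trans (normcD _ _))// normc_natr -natr1.
have := normc_ge0 l; have : 0 <= k%:R :> R by []; nra.
Qed.

Definition prabhakar_term m n l z (k : nat) : R[i] :=
  pochhammer l k / (k`!%:R * cGamma (m * k%:R + n)) * z ^+ k.

Definition cprabhakar m n l z : R[i] :=
  let s N := \sum_(0 <= k < N) prabhakar_term m n l z k in
  limn (fun N => complex.Re (s N)) +i* limn (fun N => complex.Im (s N)).

Lemma Re_affine_gt0 m n (k : nat) : 0 < complex.Re m -> 0 < complex.Re n ->
  0 < complex.Re (m * k%:R + n).
Proof. by move=> m0 n0; rewrite cReD ReMnatr ltr_wpDl// mulr_ge0// ltW. Qed.

Lemma prabhakar_termE m n l z k : 0 < complex.Re m -> 0 < complex.Re n ->
  prabhakar_term m n l z k =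
  binom_coef l k * z ^+ k / euler_integral (m * k%:R + n).
Proof.
move=> m0 n0; rewrite /prabhakar_term cGammaE ?Re_affine_gt0// invfM /binom_coef.
ring.
Qed.

Lemma prabhakar_term_le m n l (c : R) : 0 < complex.Re m -> 0 < complex.Re n -> 0 <= c ->
  exists2 C, 0 < C & forall z k, normc z <= c ->
    normc (prabhakar_term m n l z k) <= C * 2^-1 ^+ k.
Proof.
move=> m0 n0 c0.
have M0 : 0 <= normc l + 1 by rewrite addr_ge0 ?normc_ge0.
have [C C0 hC] := geometric_inv_euler_integral_le m0 n0 (mulr_ge0 M0 c0).
exists C => // z k zc; rewrite prabhakar_termE// 2!normcM normcV normcX.
apply: le_trans (hC k); rewrite exprMn ler_wpM2r ?invr_ge0 ?normc_ge0//.
rewrite ler_pM ?normc_ge0 ?exprn_ge0 ?normc_ge0 ?normc_binom_coef_le//.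
by rewrite lerXn2r ?nnegrE ?normc_ge0.
Qed.

Lemma cprabhakar_cvg m n l z : 0 < complex.Re m -> 0 < complex.Re n ->
  c_cvg (fun N => \sum_(0 <= k < N) prabhakar_term m n l z k) (cprabhakar m n l z).
Proof.
move=> m0 n0; have [C _ hC] := prabhakar_term_le l m0 n0 (normc_ge0 z).
have [L [rL iL]] := c_cvg_series (fun k => hC z k (lexx _)).
suff -> : cprabhakar m n l z = L by [].
by apply: complex_eq => /=; apply/cvg_lim.
Qed.

Lemma sum_half_le (C : R) (N : nat) : 0 <= C ->
  \sum_(0 <= k < N) C * 2^-1 ^+ k <= 2 * C.
Proof.
move=> C0; suff -> : \sum_(0 <= k < N) C * 2^-1 ^+ k = 2 * C - 2 * C * 2^-1 ^+ N.
  by rewrite gerBl !mulr_ge0 ?exprn_ge0.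
elim: N => [|N IH]; first by rewrite big_nil expr0 mulr1 subrr.
rewrite big_nat_recr//= IH exprS; lra.
Qed.

Lemma prabhakar_sum_le m n l (c : R) : 0 < complex.Re m -> 0 < complex.Re n -> 0 <= c ->
  exists C, forall z N, normc z <= c ->
    normc (\sum_(0 <= k < N) prabhakar_term m n l z k) <= C.
Proof.
move=> m0 n0 c0; have [C C0 hC] := prabhakar_term_le l m0 n0 c0.
exists (2 * C) => z N zc; rewrite (le_trans (normc_sum _ _ _))//.
rewrite (le_trans _ (sum_half_le N (ltW C0)))// ler_sum// => k _; exact: hC.
Qed.

(** The square partial sums of the double series differ from the sums over the
    triangle p+q < N by at most N^2 terms, each at most C 8^(-N).  On the
    triangle, summing along the diagonals gives the single series. *)
Lemma prabhakar_square_cvg m n a b w : 0 < complex.Re m -> 0 < complex.Re n ->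
  c_cvg (fun N => \sum_(z : 'I_N * 'I_N) binom_coef a z.1 * binom_coef b z.2 *
      w ^+ (z.1 + z.2) / euler_integral (m * (z.1 + z.2)%:R + n))
    (cprabhakar m n (a + b) w).
Proof.
move=> m0 n0.
pose H p q := binom_coef a p * binom_coef b q *
      w ^+ (p + q) / euler_integral (m * (p + q)%:R + n).
have Hdiag k : \sum_(p < k.+1) H p (k - p)%N = prabhakar_term m n (a + b) w k.
  rewrite prabhakar_termE// binom_coef_Vandermonde !mulr_suml; apply: eq_bigr => p _.
  by rewrite /H subnKC// -ltnS.
pose M := normc a + normc b + 1.
have M0 : 0 <= M by rewrite !addr_ge0 ?normc_ge0.
(* The factor 4 turns the bound C 2^(-k) into C 8^(-k), so that it beats N^2 <= 4^N. *)
have [C C0 hC] := geometric_inv_euler_integral_le m0 n0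
  (mulr_ge0 (ler0n R 4) (mulr_ge0 M0 (normc_ge0 w))).
have H_le p q : normc (H p q) <= C * 8^-1 ^+ (p + q).
  rewrite /H 3!normcM normcV normcX.
  apply: (@le_trans _ _ ((M * normc w) ^+ (p + q) /
      normc (euler_integral (m * (p + q)%:R + n)))).
    rewrite ler_wpM2r ?invr_ge0 ?normc_ge0// exprMn ler_wpM2r ?exprn_ge0 ?normc_ge0//.
    rewrite exprD ler_pM ?normc_ge0//.
      rewrite (le_trans (normc_binom_coef_le _ _))// lerXn2r ?nnegrE ?addr_ge0 ?normc_ge0//.
      by rewrite /M lerD2r lerDl normc_ge0.
    rewrite (le_trans (normc_binom_coef_le _ _))// lerXn2r ?nnegrE ?addr_ge0 ?normc_ge0//.
    by rewrite /M lerD2r lerDr normc_ge0.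
  have := hC (p + q)%N; rewrite exprMn; move: (p + q)%N => k hk.
  have p4 : 0 < 4 ^+ k :> R by rewrite exprn_gt0.
  rewrite -(ler_pM2l p4) mulrA (le_trans hk)// mulrCA ler_wpM2l ?(ltW C0)//.
  by rewrite -exprMn; rewrite (_ : 4 * 8^-1 = 2^-1 :> R)//; field.
have -> : cprabhakar m n (a + b) w = cprabhakar m n (a + b) w + 0 by rewrite addr0.
under eq_fun do rewrite (sum_square H).
apply: c_cvgD.
  under eq_fun => N do under eq_bigr do rewrite Hdiag.
  under eq_fun => N do rewrite -(big_mkord xpredT).
  exact: cprabhakar_cvg.
apply: (@c_cvg0_le _ _ (fun N => C * 2^-1 ^+ N)); last first.
  by apply: cvg_geometric; rewrite ger0_norm; lra.
move=> N; rewrite (le_trans (normc_sum _ _ _))//.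
apply: (@le_trans _ _ (\sum_(z : 'I_N * 'I_N) C * 8^-1 ^+ N)).
  rewrite big_mkcond; apply: ler_sum => z _; case: ifPn => [Nz|_]; last first.
    by rewrite mulr_ge0 ?exprn_ge0// ltW.
  rewrite (le_trans (H_le _ _))// ler_wpM2l ?(ltW C0)// ler_wiXn2l//; lra.
rewrite sumr_const card_prod card_ord -[leLHS]mulr_natr -mulrA ler_wpM2l ?(ltW C0)//.
have -> : (8^-1 : R) ^+ N = 2^-1 ^+ N * (4 ^+ N)^-1.
  by rewrite -exprVn -exprMn; congr (_ ^+ _); field.
rewrite -mulrA ler_piMr ?exprn_ge0// mulrC ler_pdivrMr ?exprn_gt0// mul1r.
by rewrite -natrX ler_nat (_ : 4 = 2 * 2)%N// expnMn leq_mul// ltnW// ltn_expl.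
Qed.

End PrabhakarSeries.

(** * The convolution identity over the complex numbers *)

Section PrabhakarConvolution.
Context {R : realType}.
Local Notation mu := (@lebesgue_measure R).
Local Notation TR := (measurableTypeR R).
Variables (m n l nu sigma r : R[i]) (x : R).
Hypotheses (m0 : 0 < complex.Re m) (n0 : 0 < complex.Re n)
  (nu0 : 0 < complex.Re nu) (x0 : 0 < x).

Let coef (k a : R[i]) (p : nat) : R[i] :=
  binom_coef a p * r ^+ p / euler_integral (m * p%:R + k).

Let kernel_termE (k a : R[i]) (s : R) (p : nat) : 0 < complex.Re k -> 0 < s ->
  crpow s (k - 1) * prabhakar_term m k a (r * crpow s m) p =
  coef k a p * ckernel (m * p%:R + k) s.
Proof.
move=> k0 s0; rewrite prabhakar_termE// exprMn -crpowMn /ckernel s0 /coef.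
rewrite -addrA (crpowD s (m * p%:R)).
move: (crpow s _) (crpow s _) (euler_integral _)^-1 => X Y Z; ring.
Qed.

(** The product of the partial sums of the two series, expanded into kernels.
    It is defined on the whole line, where it vanishes outside ]0, x[. *)
Let partial (N : nat) (t : R) : R[i] := \sum_(z : 'I_N * 'I_N)
  (coef n l z.1 * coef nu sigma z.2) *
  (ckernel (m * z.1%:R + n) (x - t) * ckernel (m * z.2%:R + nu) t).

Let partialE N t : 0 < t < x -> partial N t =
  crpow (x - t) (n - 1) *
    (\sum_(0 <= p < N) prabhakar_term m n l (r * crpow (x - t) m) p) *
  crpow t (nu - 1) * (\sum_(0 <= q < N) prabhakar_term m nu sigma (r * crpow t m) q).
Proof.
move=> /andP[t0 tx]; have xt0 : 0 < x - t by rewrite subr_gt0.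
rewrite -mulrA [X in _ = X * _]mulr_sumr [X in _ = _ * X]mulr_sumr !big_mkord.
under [X in _ = X * _]eq_bigr do rewrite kernel_termE//.
under [X in _ = _ * X]eq_bigr do rewrite kernel_termE//.
rewrite big_distrlr /= pair_bigA /=; apply: eq_bigr => z _; ring.
Qed.

Let partial_integrable N : c_integrable setT (partial N).
Proof.
apply: c_integrable_sum => // z.
by apply: c_integrable_conv; exact: Re_affine_gt0.
Qed.

(** Here the Gamma factors of the coefficients cancel against the Beta
    integral. *)
Let integral_partial N : c_integral setT (partial N) =
  crpow x (n + nu - 1) * \sum_(z : 'I_N * 'I_N)
    binom_coef l z.1 * binom_coef sigma z.2 * (r * crpow x m) ^+ (z.1 + z.2) /
    euler_integral (m * (z.1 + z.2)%:R + (n + nu)).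
Proof.
rewrite c_integral_sum//; last first.
  by move=> z; apply: c_integrable_conv; exact: Re_affine_gt0.
rewrite mulr_sumr; apply: eq_bigr => -[p q] _ /=.
have p0 := Re_affine_gt0 p m0 n0; have q0 := Re_affine_gt0 q m0 nu0.
rewrite ckernel_conv//.
have E : m * p%:R + n + (m * q%:R + nu) = m * (p + q)%:R + (n + nu).
  by rewrite natrD; ring.
have := euler_integralM p0 q0; rewrite E.
have := euler_integral_neq0 q0; have := euler_integral_neq0 p0.
have : euler_integral (m * (p + q)%:R + (n + nu)) != 0.
  by rewrite euler_integral_neq0// Re_affine_gt0// cReD addr_gt0.
have Ex : crpow x (m * (p + q)%:R + (n + nu) - 1) =
    crpow x m ^+ (p + q) * crpow x (n + nu - 1).
  by rewrite -(addrA (m * _)) (crpowD x (m * _)) crpowMn.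
rewrite /ckernel x0 Ex exprMn (exprD r) /coef.
move: (crpow x (n + nu - 1)) (crpow x m ^+ _) (euler_integral (m * (p + q)%:R + _))
  (euler_integral (m * p%:R + n)) (euler_integral (m * q%:R + nu)) (cbeta _ _).
move=> X Y G Gp Gq B G0 Gp0 Gq0 EB.
have -> : B = Gp * Gq / G by rewrite EB mulrAC mulfV ?mul1r.
field.
by rewrite G0 Gp0 Gq0.
Qed.

Let integral_partial_itv N : c_integral `]0, x[ (partial N) = c_integral setT (partial N).
Proof.
rewrite c_integral_mkcond; apply: eq_c_integral => t _.
rewrite mem_setE in_itv/=; case: ifPn => // tx; rewrite /partial big1// => z _.
rewrite /ckernel subr_gt0.
by move: tx; rewrite negb_and => /orP[] /negbTE ->; rewrite ?mulr0 ?mul0r ?mulr0.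
Qed.

Let F (t : R) : R[i] := crpow (x - t) (n - 1) * cprabhakar m n l (r * crpow (x - t) m) *
  crpow t (nu - 1) * cprabhakar m nu sigma (r * crpow t m).

Let partial_cvg t : 0 < t < x -> c_cvg (partial ^~ t) (F t).
Proof.
move=> tx; under eq_fun do rewrite partialE//.
by do !apply: c_cvgM; (exact: c_cvg_cst || exact: cprabhakar_cvg).
Qed.

Let normc_arg_le (s : R) : 0 < s <= x -> normc (r * crpow s m) <= normc r * x `^ complex.Re m.
Proof.
move=> /andP[s0 sx]; rewrite normcM normc_crpow// ler_wpM2l ?normc_ge0//.
by rewrite ge0_ler_powR ?nnegrE// ltW.
Qed.

Let partial_dominated : exists C, forall N t, 0 < t < x ->
  normc (partial N t) <= C * (rkernel (complex.Re n) (x - t) * rkernel (complex.Re nu) t).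
Proof.
have c0 : 0 <= normc r * x `^ complex.Re m by rewrite mulr_ge0 ?normc_ge0 ?powR_ge0.
have [C1 h1] := prabhakar_sum_le l m0 n0 c0.
have [C2 h2] := prabhakar_sum_le sigma m0 nu0 c0.
exists (C1 * C2) => N t /[dup] tx /andP[t0 xt].
have xt0 : 0 < x - t by rewrite subr_gt0.
rewrite partialE// !normcM.
have kE (a : R[i]) (s : R) : 0 < s -> normc (crpow s (a - 1)) = rkernel (complex.Re a) s.
  by move=> s0; rewrite -normc_ckernel /ckernel s0.
rewrite !kE//.
have g1 := h1 (r * crpow (x - t) m) N; have g2 := h2 (r * crpow t m) N.
have {}g1 := g1 (normc_arg_le _); have {}g2 := g2 (normc_arg_le _).
rewrite xt0 gerBl (ltW t0) in g1; rewrite t0 (ltW xt) in g2.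
have {}g1 := g1 isT; have {}g2 := g2 isT.
rewrite mulrACA [leLHS](_ : _ = (normc (\sum_(0 <= p < N) prabhakar_term m n l (r * crpow (x - t) m) p)
  * normc (\sum_(0 <= q < N) prabhakar_term m nu sigma (r * crpow t m) q)) *
  (rkernel (complex.Re n) (x - t) * rkernel (complex.Re nu) t)); last by ring.
rewrite mulrACA ler_wpM2r ?mulr_ge0 ?rkernel_ge0//.
by rewrite ler_pM ?normc_ge0.
Qed.

(** Dominated convergence for the partial products, whose integrals are the
    square partial sums of [prabhakar_square_cvg]. *)
Lemma cprabhakar_convolution : c_integrable `]0, x[ F /\
  c_integral `]0, x[ F =
    crpow x (n + nu - 1) * cprabhakar m (n + nu) (l + sigma) (r * crpow x m).
Proof.
have [C hC] := partial_dominated.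
pose g t := C * (rkernel (complex.Re n) (x - t) * rkernel (complex.Re nu) t).
have mD : measurable (`]0, x[%classic : set TR) by [].
have ig : mu.-integrable `]0, x[ (EFin \o g).
  have ig0 : mu.-integrable setT (EFin \o
      (fun t => rkernel (complex.Re n) (x - t) * rkernel (complex.Re nu) t)).
    exact: integrable_rconv.
  have := integrableZl mD C (integrableS measurableT mD (@subsetT _ _) ig0).
  by apply: eq_integrable => // t _; rewrite /= EFinM.
have mp N : c_measurable (`]0, x[%classic : set TR) (partial N).
  have [mr mi] := c_integrable_measurable (partial_integrable N).
  by split; exact: measurable_funTS.
have [iF limF] : c_integrable `]0, x[ F /\
    c_cvg (fun N => c_integral `]0, x[ (partial N)) (c_integral `]0, x[ F).
  apply: (c_dominated_convergence mD mp _ ig) => [t|N t] /=; rewrite in_itv/=.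
    exact: partial_cvg.
  exact: hC.
split => //; apply: c_cvg_unique limF _.
under eq_fun do rewrite integral_partial_itv integral_partial.
apply: c_cvgM; first exact: c_cvg_cst.
by apply: prabhakar_square_cvg; rewrite ?cReD ?addr_gt0.
Qed.

End PrabhakarConvolution.

(** * Reduction of the bicomplex statement to its idempotent components *)

Section Bicomplex.
Context {R : realType}.
Implicit Types (m n l z xi zeta : bicomplex R).

Lemma bc_lim_idem (s : nat -> bicomplex R) (L1 L2 : R[i]) :
  c_cvg (fun N => bc_idem1 (s N)) L1 -> c_cvg (fun N => bc_idem2 (s N)) L2 ->
  bc_lim s = bc_of_idem L1 L2.
Proof.
move=> [r1 i1] [r2 i2]; rewrite bc_of_idemE /bc_lim.
have E N : s N = bc_of_idem (bc_idem1 (s N)) (bc_idem2 (s N)) by rewrite bc_idemK.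
have half (u : nat -> R) (v : R) : u @ \oo --> v -> (fun N => u N / 2) @ \oo --> v / 2.
  by move=> uv; apply: cvgM => //; exact: cvg_cst.
congr Bicomplex; apply/cvg_lim => //; under eq_fun do rewrite E bc_of_idemE /=;
  apply: half.
- exact: cvgD.
- exact: cvgD.
- exact: cvgB.
- exact: cvgB.
Qed.

Lemma Re_idem_gt0 xi : `|bc_Imj xi| < bc_Re xi ->
  0 < complex.Re (bc_idem1 xi) /\ 0 < complex.Re (bc_idem2 xi).
Proof.
by rewrite ltr_norml bc_idem1E bc_idem2E /bc_Imj /bc_Re /= => /andP[h1 h2]; split; lra.
Qed.

Lemma cGamma_neq0 (z : R[i]) : 0 < complex.Re z -> cGamma z != 0.
Proof. by move=> z0; rewrite cGammaE// euler_integral_neq0. Qed.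

Lemma bc_unitE xi : (xi \is a GRing.unit) = (bc_idem1 xi != 0) && (bc_idem2 xi != 0).
Proof. by []. Qed.

Lemma idem_pochhammer (phi : {rmorphism bicomplex R -> R[i]}) l (k : nat) :
  phi (pochhammer l k) = pochhammer (phi l) k.
Proof.
by rewrite rmorph_prod; apply: eq_bigr => i _; rewrite rmorphD rmorph_nat.
Qed.

Lemma idem1_rpow (t : R) xi : bc_idem1 (bc_rpow t xi) = crpow t (bc_idem1 xi).
Proof. exact: bc_of_idemK1. Qed.

Lemma idem2_rpow (t : R) xi : bc_idem2 (bc_rpow t xi) = crpow t (bc_idem2 xi).
Proof. exact: bc_of_idemK2. Qed.

Lemma idem1M xi zeta : bc_idem1 (xi * zeta) = bc_idem1 xi * bc_idem1 zeta.
Proof. exact: rmorphM. Qed.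

Lemma idem1B1 xi : bc_idem1 (xi - 1) = bc_idem1 xi - 1.
Proof. by rewrite rmorphB rmorph1. Qed.

Lemma idem2M xi zeta : bc_idem2 (xi * zeta) = bc_idem2 xi * bc_idem2 zeta.
Proof. exact: rmorphM. Qed.

Lemma idem2B1 xi : bc_idem2 (xi - 1) = bc_idem2 xi - 1.
Proof. by rewrite rmorphB rmorph1. Qed.

Section PrabhakarIdem.
Variables (m n l z : bicomplex R).
Hypotheses (hm : `|bc_Imj m| < bc_Re m) (hn : `|bc_Imj n| < bc_Re n).

Let term (k : nat) : bicomplex R :=
  pochhammer l k / (k`!%:R * bc_Gamma (m * k%:R + n)) * z ^+ k.

(** Only for a unit is the bicomplex inverse computed componentwise; this is
    where the non-vanishing of Gamma enters. *)
Let denominator_unit (k : nat) :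
  k`!%:R * bc_Gamma (m * k%:R + n) \is a GRing.unit.
Proof.
have [m1 m2] := Re_idem_gt0 hm; have [n1 n2] := Re_idem_gt0 hn.
have k0 : k`!%:R != 0 :> R[i] by rewrite pnatr_eq0 -lt0n fact_gt0.
rewrite bc_unitE; apply/andP; split.
  rewrite rmorphM rmorph_nat /= bc_of_idemK1; apply: mulf_neq0 => //; apply: cGamma_neq0.
  by rewrite rmorphD rmorphM rmorph_nat; exact: Re_affine_gt0.
rewrite rmorphM rmorph_nat /= bc_of_idemK2; apply: mulf_neq0 => //; apply: cGamma_neq0.
by rewrite rmorphD rmorphM rmorph_nat; exact: Re_affine_gt0.
Qed.

Let idem1_term k : bc_idem1 (term k) =
  prabhakar_term (bc_idem1 m) (bc_idem1 n) (bc_idem1 l) (bc_idem1 z) k.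
Proof.
rewrite !rmorphM rmorphXn rmorphV ?denominator_unit//= idem_pochhammer.
by rewrite rmorphM rmorph_nat /= bc_of_idemK1 rmorphD rmorphM rmorph_nat.
Qed.

Let idem2_term k : bc_idem2 (term k) =
  prabhakar_term (bc_idem2 m) (bc_idem2 n) (bc_idem2 l) (bc_idem2 z) k.
Proof.
rewrite !rmorphM rmorphXn rmorphV ?denominator_unit//= idem_pochhammer.
by rewrite rmorphM rmorph_nat /= bc_of_idemK2 rmorphD rmorphM rmorph_nat.
Qed.

Lemma prabhakar_idem : prabhakar m n l z =
  bc_of_idem (cprabhakar (bc_idem1 m) (bc_idem1 n) (bc_idem1 l) (bc_idem1 z))
             (cprabhakar (bc_idem2 m) (bc_idem2 n) (bc_idem2 l) (bc_idem2 z)).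
Proof.
have [m1 m2] := Re_idem_gt0 hm; have [n1 n2] := Re_idem_gt0 hn.
apply: bc_lim_idem; under eq_fun do rewrite rmorph_sum /=.
  under eq_fun do under eq_bigr do rewrite idem1_term.
  exact: cprabhakar_cvg.
under eq_fun do under eq_bigr do rewrite idem2_term.
exact: cprabhakar_cvg.
Qed.

Lemma idem1_prabhakar : bc_idem1 (prabhakar m n l z) =
  cprabhakar (bc_idem1 m) (bc_idem1 n) (bc_idem1 l) (bc_idem1 z).
Proof. by rewrite prabhakar_idem bc_of_idemK1. Qed.

Lemma idem2_prabhakar : bc_idem2 (prabhakar m n l z) =
  cprabhakar (bc_idem2 m) (bc_idem2 n) (bc_idem2 l) (bc_idem2 z).
Proof. by rewrite prabhakar_idem bc_of_idemK2. Qed.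

End PrabhakarIdem.
End Bicomplex.

Unset Implicit Arguments.

Theorem theorem2p2 (R : realType) (m n l nu sigma r : bicomplex R)
    (hm : `|bc_Imj m| < bc_Re m)
    (hn : `|bc_Imj n| < bc_Re n)
    (hnu : `|bc_Imj nu| < bc_Re nu)
    (x : R) (hx : 0 < x) :
  let F := fun t : R =>
    bc_rpow (x - t) (n - 1) * prabhakar m n l (r * bc_rpow (x - t) m)
    * bc_rpow t (nu - 1) * prabhakar m nu sigma (r * bc_rpow t m) in
  bc_integrable `]0, x[ F /\
  bc_integral `]0, x[ F =
    bc_rpow x (n + nu - 1) * prabhakar m (n + nu) (l + sigma) (r * bc_rpow x m).
Proof.
move=> F.
have [m1 m2] := Re_idem_gt0 hm; have [n1 n2] := Re_idem_gt0 hn.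
have [nu1 nu2] := Re_idem_gt0 hnu.
have hnnu : `|bc_Imj (n + nu)| < bc_Re (n + nu).
  by rewrite (le_lt_trans (ler_normD _ _))// ltrD.
have [iF1 eF1] := cprabhakar_convolution (bc_idem1 l) (bc_idem1 sigma) (bc_idem1 r) m1 n1 nu1 hx.
have [iF2 eF2] := cprabhakar_convolution (bc_idem2 l) (bc_idem2 sigma) (bc_idem2 r) m2 n2 nu2 hx.
have F1 : (fun t => bc_idem1 (F t)) = (fun t => crpow (x - t) (bc_idem1 n - 1) *
    cprabhakar (bc_idem1 m) (bc_idem1 n) (bc_idem1 l)
      (bc_idem1 r * crpow (x - t) (bc_idem1 m)) * crpow t (bc_idem1 nu - 1) *
    cprabhakar (bc_idem1 m) (bc_idem1 nu) (bc_idem1 sigma)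
      (bc_idem1 r * crpow t (bc_idem1 m))).
  apply/funext => t; rewrite /F 3!idem1M; congr (_ * _ * _ * _).
  - by rewrite idem1_rpow idem1B1.
  - by rewrite (idem1_prabhakar l _ hm hn) idem1M idem1_rpow.
  - by rewrite idem1_rpow idem1B1.
  - by rewrite (idem1_prabhakar sigma _ hm hnu) idem1M idem1_rpow.
have F2 : (fun t => bc_idem2 (F t)) = (fun t => crpow (x - t) (bc_idem2 n - 1) *
    cprabhakar (bc_idem2 m) (bc_idem2 n) (bc_idem2 l)
      (bc_idem2 r * crpow (x - t) (bc_idem2 m)) * crpow t (bc_idem2 nu - 1) *
    cprabhakar (bc_idem2 m) (bc_idem2 nu) (bc_idem2 sigma)
      (bc_idem2 r * crpow t (bc_idem2 m))).
  apply/funext => t; rewrite /F 3!idem2M; congr (_ * _ * _ * _).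
  - by rewrite idem2_rpow idem2B1.
  - by rewrite (idem2_prabhakar l _ hm hn) idem2M idem2_rpow.
  - by rewrite idem2_rpow idem2B1.
  - by rewrite (idem2_prabhakar sigma _ hm hnu) idem2M idem2_rpow.
rewrite /bc_integrable /bc_integral F1 F2; split => //.
rewrite (congr2 (@bc_of_idem R) eF1 eF2); apply: bc_idem_inj.
  rewrite bc_of_idemK1 idem1M; congr (_ * _).
    by rewrite idem1_rpow idem1B1 rmorphD.
  by rewrite (idem1_prabhakar _ _ hm hnnu) idem1M idem1_rpow 2!rmorphD.
rewrite bc_of_idemK2 idem2M; congr (_ * _).
  by rewrite idem2_rpow idem2B1 rmorphD.
by rewrite (idem2_prabhakar _ _ hm hnnu) idem2M idem2_rpow 2!rmorphD.
Qed.
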